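(* Let $G$ be a locally compact, second countable, amenable (Hausdorff) topological group such that $G/G_0$ is not compact, where $G_0$ is the intersection of the kernels of all finite-dimensional representations of $G$. Then for any left Følner sequence $\Phi$ in $G$ and any $\varepsilon>0$ there is a measurable subset $E$ of $G$ such that the density $\mathrm{d}_\Phi(E)$ exists, $\mathrm{d}_\Phi(E)>1-\varepsilon$, and no set of the form $KEK$ with $K\subset G$ compact contains a set of measurable recurrence.
   Context: Fix a left Haar measure $\mathrm{m}$ on $G$. A left Følner sequence is a sequence $N\mapsto\Phi_N$ of compact, positive-measure subsets of $G$ such that $\lim_{N\to\infty}\mathrm{m}(\Phi_N\cap g\Phi_N)/\mathrm{m}(\Phi_N)=1$ uniformly for $g$ in compact subsets of $G$. The density of a measurable $E\subset G$ with respect to $\Phi$ is $\mathrm{d}_\Phi(E)=\lim_{N\to\infty}\mathrm{m}(E\cap\Phi_N)/\mathrm{m}(\Phi_N)$ when the limit exists. A representation of $G$ is a continuous homomorphism from $G$ to the unitary group of a complex Hilbert space. $G_0$ (the von Neumann kernel) is a closed normal subgroup of $G$. A measure-preserving action of $G$ on a separable probability space $(X,\mathscr{B},\mu)$ is a jointly measurable map $T:G\times X\to X$ such that the induced maps $T^g:X\to X$ preserve $\mu$ and satisfy $T^gT^h=T^{gh}$ for all $g,h\in G$. A subset $R\subset G$ is a set of measurable recurrence if for every compact $K\subset G$, every measure-preserving action $T$ of $G$ on a separable probability space $(X,\mathscr{B},\mu)$, and every measurable $A\subset X$ with $\mu(A)>0$, there exists $g\in R\setminus K$ such that $\mu(A\cap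 T^gA)>0$. *)

(* Defs.v *)
From HB Require Import structures.
From mathcomp Require Import all_boot all_order all_algebra.
From mathcomp Require Import complex.
From mathcomp Require Import all_classical all_reals all_analysis.

Set Implicit Arguments.
Unset Strict Implicit.
Unset Printing Implicit Defensive.

Import Order.TTheory GRing.Theory Num.Theory.
Import numFieldNormedType.Exports.

Local Open Scope classical_set_scope.
Local Open Scope ring_scope.
Local Open Scope complex_scope.
Local Open Scope quotient_scope.

HB.mixin Record isTopologicalGroup G & Topological G & Group G := {
  mulg_continuous : continuous (fun x : G * G => (x.1 * x.2)%g) ;
  invg_continuous : continuous (fun x : G => x^-1%g)
}.

(* The distinguished point carries no information (a group is inhabited); it is
   there because [measurableType] requires pointed carriers. *)
#[short(type="topologicalGroupType")]
HB.structure Definition TopologicalGroup :=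
  {G of PointedTopological G & Group G & isTopologicalGroup G}.

Notation borel G := (g_sigma_algebraType (@open G)).

Section TopologicalGroup.
Variable G : topologicalGroupType.

Definition left_translate (g : G) (A : set G) : set G :=
  [set (g * x)%g | x in A].

Definition two_sided_thickening (K A : set G) : set G :=
  [set g | exists k x l, [/\ K k, A x, K l & g = (k * x * l)%g]].

End TopologicalGroup.

Section Representation.
Variables (R : realType) (G : topologicalGroupType).

(* A finite-dimensional complex Hilbert space is a [vectType R[i]] with a
   positive definite hermitian form; completeness is automatic.  Surjectivity
   of each [rho g] follows from the homomorphism laws, and continuity is with
   respect to the strong operator topology, which in finite dimension is the
   norm topology. *)
Record unitary_representation (V : vectType R[i])
    (dot : {dot V for (@Num.conj R[i])}) (rho : G -> 'End(V)) : Prop := {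
  repr_one : rho 1%g = \1%VF ;
  repr_mul : forall g h, rho (g * h)%g = (rho g \o rho h)%VF ;
  repr_unitary : forall g u v, dot (rho g u) (rho g v) = dot u v ;
  repr_continuous : forall g v (e : R), 0 < e ->
    \forall h \near g, dot (rho h v - rho g v) (rho h v - rho g v) < e%:C
}.

Definition von_neumann_kernel : set G :=
  [set g | forall (V : vectType R[i]) (dot : {dot V for (@Num.conj R[i])})
                  (rho : G -> 'End(V)),
             unitary_representation dot rho -> rho g = \1%VF].

Definition coset_eq (x y : G) : bool :=
  `[< von_neumann_kernel (x^-1 * y)%g >].

Lemma coset_eq_refl : reflexive coset_eq.
Proof.
by move=> x; apply/asboolP => V dot rho rhoP; rewrite mulVg (repr_one rhoP).
Qed.

Lemma coset_eq_sym : symmetric coset_eq.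
Proof.
suff H x y : coset_eq x y -> coset_eq y x by move=> x y; apply/idP/idP => /H.
move=> /asboolP xy; apply/asboolP => V dot rho rhoP.
have := repr_mul rhoP (x^-1 * y)%g (y^-1 * x)%g.
rewrite (xy _ _ _ rhoP) comp_lfun1l -mulgA mulVKg mulVg => <-.
exact: repr_one rhoP.
Qed.

Lemma coset_eq_trans : transitive coset_eq.
Proof.
move=> y x z /asboolP xy /asboolP yz; apply/asboolP => V dot rho rhoP.
have := repr_mul rhoP (x^-1 * y)%g (y^-1 * z)%g.
by rewrite (xy _ _ _ rhoP) (yz _ _ _ rhoP) comp_lfun1l -mulgA mulVKg.
Qed.

Canonical coset_eq_equiv :=
  EquivRel coset_eq coset_eq_refl coset_eq_sym coset_eq_trans.

Definition von_neumann_quotient : topologicalType :=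
  quotient_topology {eq_quot coset_eq}.

End Representation.

Section Haar.
Variables (R : realType) (G : topologicalGroupType).
Implicit Types (m : {measure set (borel G) -> \bar R}) (Phi : nat -> set G).

Record left_Haar_measure m : Prop := {
  haar_neq0 : m setT != 0%E ;
  haar_compact : forall K : set G, compact K -> (m K < +oo)%E ;
  haar_outer_regular : forall A : set (borel G), measurable A ->
    m A = ereal_inf [set m U | U in [set U : set G | open U /\ A `<=` U]] ;
  haar_inner_regular : forall U : set G, open U ->
    m U = ereal_sup [set m K | K in [set K : set G | compact K /\ K `<=` U]] ;
  haar_left_invariant : forall g (A : set (borel G)), measurable A ->
    m (left_translate g A) = m A
}.

(* Existence of a left-invariant mean on L^oo(G, m).  The mean is a function on
   representatives; linearity and positivity make it invariant under a.e.
   equality, and its values outside [Lfun m +oo] are irrelevant. *)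
Definition amenable m : Prop :=
  exists M : (borel G -> R) -> R,
    [/\ forall (a : R) f1 f2, f1 \in Lfun m +oo%E -> f2 \in Lfun m +oo%E ->
          M (fun x => a * f1 x + f2 x) = a * M f1 + M f2,
        forall f, f \in Lfun m +oo%E -> {ae m, forall x, 0 <= f x} -> 0 <= M f,
        M (cst 1) = 1 &
        forall g f, f \in Lfun m +oo%E ->
          M (fun x => f (g^-1 * x)%g) = M f].

(* [m A / m B] as a real number, for [m B] positive and finite. *)
Definition relative_measure m (A B : set G) : R :=
  fine (m (A `&` B)) / fine (m B).

Record left_Folner m Phi : Prop := {
  folner_compact : forall N, compact (Phi N) ;
  folner_gt0 : forall N, (0 < m (Phi N))%E ;
  folner_lim : forall K : set G, compact K ->
    {uniform K, (fun N (g : G) =>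
        relative_measure m (left_translate g (Phi N)) (Phi N)) @ \oo
      --> (cst 1 : G -> R)}
}.

Definition has_density m Phi (E : set G) : Prop :=
  cvgn (fun N => relative_measure m E (Phi N)).

Definition density m Phi (E : set G) : R :=
  limn (fun N => relative_measure m E (Phi N)).

End Haar.

Section Recurrence.
Variables (R : realType) (G : topologicalGroupType).

Record measure_preserving_action d (X : measurableType d)
    (mu : probability X R) (T : G -> X -> X) : Prop := {
  action_measurable :
    measurable_fun setT (fun gx : borel G * X => T gx.1 gx.2) ;
  action_preserving : forall g (A : set X), measurable A ->
    mu (T g @^-1` A) = mu A ;
  action_one : forall x, T 1%g x = x ;
  action_mul : forall g h x, T (g * h)%g x = T g (T h x)
}.

(* Separability of the measure algebra of mu for the metric mu(A \triangle B),
   equivalently of L^2(X, mu). *)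
Definition separable_probability d (X : measurableType d)
    (mu : probability X R) : Prop :=
  exists C : nat -> set X, (forall n, measurable (C n)) /\
    forall (A : set X) (e : R), measurable A -> 0 < e ->
      exists n, (mu ((A `\` C n) `|` (C n `\` A)) < e%:E)%E.

Definition measurable_recurrence (S : set G) : Prop :=
  forall K : set G, compact K ->
  forall (d : measure_display) (X : measurableType d) (mu : probability X R)
         (T : G -> X -> X),
    separable_probability mu -> measure_preserving_action mu T ->
  forall A : set X, measurable A -> (0 < mu A)%E ->
  exists g, (S `\` K) g /\ (0 < mu (A `&` T g @` A))%E.

End Recurrence.

(* Main.v *)
Require Import Defs.
From HB Require Import structures.
From mathcomp Require Import all_boot all_order all_algebra.
From mathcomp Require Import complex lra ring.
From mathcomp Require Import all_classical all_reals all_analysis.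
From mathcomp Require Import ess_sup_inf measurable_realfun.

Set Implicit Arguments.
Unset Strict Implicit.
Unset Printing Implicit Defensive.

Import Order.TTheory GRing.Theory Num.Theory.
Import numFieldNormedType.Exports.

Local Open Scope classical_set_scope.
Local Open Scope ring_scope.

(* Fix a compact [K] and let [d > 0].  Since [G / G_0] is not compact, a compact
   set has arbitrarily many translates that are pairwise disjoint modulo [G_0],
   and by compactness a single finite-dimensional representation [r] separates
   them.  Hence the Bohr set [D] of points [r]-close to [K^-1 K^-1] has many
   disjoint left translates, so its density is small.  [D] contains
   [K^-1 U K^-1] for a set [U = {u : r u close to 1}], and [U] contains all
   return times of a small ball around 1 under the action of [G] on matrices
   through [r], for an invariant probability measure supported on the closure of
   [r G]; so a set of measurable recurrence meets [U] outside every compact set.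
   For an exhaustion [K_n] of [G] by compact sets, [E] is the complement of the
   union of the [D_n \ C_n], with [C_n] compact and large enough for the
   relative measures of [D_n \ C_n] to be summable uniformly along the Folner
   sequence.  Densities of Bohr sets exist off countably many radii, because the
   relative measures of a Bohr set in any two late Folner sets can be compared
   with an invariant mean; all radii are adjusted simultaneously. *)

(** * Monotone families of sequences *)

Section CountableJumps.
Variable R : realType.

(** The nonempty intervals between [l t] and [u t] are pairwise disjoint, and each contains a
    rational, which can serve only one [t]. *)
Lemma countable_jumps (l u : R -> R) :
  (forall s t, s < t -> u s <= l t) -> countable [set t | l t < u t].
Proof.
move=> ul; apply: (@sub_countable _ _ _
  (\bigcup_(q in [set: rat]) [set t | l t < ratr q < u t])); last first.
  apply: bigcup_countable => // q _; apply: finite_set_countable.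
  have [[t /andP[lt tu]]|nt] := pselect (exists t, l t < ratr q < u t); last first.
    by apply: (@sub_finite_set _ _ set0) => // t qt; apply: nt; exists t.
  apply: (@sub_finite_set _ _ [set t]) => // s /= /andP[ls su].
  have [st|ts|//] := ltgtP s t.
    by have := ul _ _ st; rewrite leNgt (lt_trans lt su).
  by have := ul _ _ ts; rewrite leNgt (lt_trans ls tu).
apply/subset_card_le => t /= /rat_in_itvoo[q]; rewrite in_itv/= => qt.
by exists q.
Qed.

(** The lower and upper limits of [a t] are [sup (L t)] and [inf (U t)]. The second hypothesis
    bounds the upper limit at [s] by the lower limit at any [t > s], so a gap between the two limits
    is a jump. *)
Lemma cvg_off_countable (a : R -> nat -> R) :
  (forall t n, 0 <= a t n <= 1) ->
  (forall s t e, s < t -> 0 < e -> \forall n \near \oo, forall p q,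
    (n <= p)%N -> (n <= q)%N -> a s p <= a t q + e) ->
  countable [set t | ~ cvgn (a t)].
Proof.
move=> a01 ast.
pose L t := [set x | exists n, forall p, (n <= p)%N -> x <= a t p].
pose U t := [set x | exists n, forall p, (n <= p)%N -> a t p <= x].
have L0 t : has_sup (L t).
  split; first by exists 0, 0%N => p _; case/andP: (a01 t p).
  exists 1 => x [n /(_ n (leqnn _))] /le_trans; apply.
  by case/andP: (a01 t n).
have U0 t : has_inf (U t).
  split; first by exists 1, 0%N => p _; case/andP: (a01 t p).
  exists 0 => x [n /(_ n (leqnn _))]; apply: le_trans.
  by case/andP: (a01 t n).
apply: (@sub_countable _ _ _ [set t | sup (L t) < inf (U t)]); last first.
  apply: countable_jumps => s t st; apply/ler_addgt0Pr => e e0.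
  have [n _ /(_ n (leqnn _)) an] := ast _ _ _ st e0.
  pose S := sup [set a s p | p in [set p | (n <= p)%N]].
  have hS : has_sup [set a s p | p in [set p | (n <= p)%N]].
    split; first by exists (a s n), n => /=.
    by exists 1 => _ [p _ <-]; case/andP: (a01 s p).
  apply: (@le_trans _ _ S).
    apply: ge_inf; first by case: (U0 s).
    by exists n => p np; apply: ub_le_sup; [case: hS|exists p].
  rewrite -lerBlDr; apply: ub_le_sup; first by case: (L0 t).
  exists n => q nq; rewrite lerBlDr; apply: ge_sup; first by case: hS.
  by move=> _ [p np <-]; exact: an.
apply/subset_card_le => t /=; apply: contra_notP => /negP.
rewrite -leNgt => ULt; apply/cvg_ex; exists (sup (L t)).
apply/cvgrPdist_lt => e e0.
have [x [n xa] xL] := sup_adherent e0 (L0 t).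
have [y [n' ya] yU] := inf_adherent e0 (U0 t).
exists (maxn n n') => // p /=; rewrite geq_max => /andP[np n'p].
have := xa _ np; have := ya _ n'p; rewrite ltr_distlC; lra.
Qed.

End CountableJumps.

(** * Relative measures along a Folner sequence *)

Section BorelGroup.
Variable G : topologicalGroupType.

Lemma open_borel (A : set G) : open A -> measurable (A : set (borel G)).
Proof. by move=> oA; exact: sub_sigma_algebra. Qed.

Lemma closed_borel (A : set G) : closed A -> measurable (A : set (borel G)).
Proof.
move=> cA; rewrite -[A]setCK; apply: (@measurableC _ (borel G)).
by apply: open_borel; exact: closed_openC.
Qed.

Lemma continuous_borel (f : G -> G) (A : set G) : continuous f ->
  measurable (A : set (borel G)) -> measurable (f @^-1` A : set (borel G)).
Proof.
move=> cf mA; rewrite -[_ @^-1` _]setTI.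
have : measurable_fun setT (f : borel G -> borel G).
  2: by move=> /(_ measurableT _ mA).
apply: (@measurability _ _ (borel G) (borel G) setT f (@open G) erefl) => _ [B oB <-]; rewrite setTI.
by apply: open_borel; apply: open_comp.
Qed.

Lemma mulg_continuousl (g : G) : continuous (fun x : G => (g * x)%g).
Proof.
move=> x; apply: (@continuous_comp _ _ _ (pair g) (fun p : G * G => (p.1 * p.2)%g)).
  by apply: cvg_pair; [exact: cvg_cst|exact: cvg_id].
exact: mulg_continuous.
Qed.

Lemma left_translateE (g : G) (A : set G) :
  left_translate g A = (fun x => (g^-1 * x)%g) @^-1` A.
Proof.
rewrite eqEsubset; split=> [_ [x Ax <-]|x Ax]; first by rewrite /= mulKg.
by exists (g^-1 * x)%g => //; rewrite mulVKg.
Qed.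

Lemma measurable_left_translate (g : G) (A : set G) :
  measurable (A : set (borel G)) -> measurable (left_translate g A : set (borel G)).
Proof.
by move=> mA; rewrite left_translateE; apply: continuous_borel => //;
  exact: mulg_continuousl.
Qed.

End BorelGroup.

Section RelativeMeasure.
Variables (R : realType) (G : topologicalGroupType).
Variable m : {measure set (borel G) -> \bar R}.
Variable Phi : nat -> set G.
Hypotheses (hG : hausdorff_space G) (hm : left_Haar_measure m).
Hypothesis hPhi : left_Folner m Phi.
Implicit Types A B : set (borel G).

Local Notation rel A N := (relative_measure m A (Phi N)).

Lemma compact_folner N : compact (Phi N).
Proof. exact: (folner_compact hPhi). Qed.

Lemma measurable_folner N : measurable (Phi N : set (borel G)).
Proof.
apply: closed_borel; apply: compact_closed => //.
exact: compact_folner.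
Qed.

Local Hint Resolve measurable_folner : core.

Lemma folner_ltey N : (m (Phi N) < +oo)%E.
Proof. by apply: (haar_compact hm); exact: compact_folner. Qed.

Lemma folner_fin_num A N : measurable A -> m (A `&` Phi N) \is a fin_num.
Proof.
move=> mA; rewrite ge0_fin_numE//.
apply: (@le_lt_trans _ _ (m (Phi N))).
  by apply: le_measure => //; rewrite inE//; exact: measurableI.
exact: folner_ltey.
Qed.

Lemma fine_folner_gt0 N : 0 < fine (m (Phi N)).
Proof.
by rewrite fine_gt0// (folner_gt0 hPhi)/= folner_ltey.
Qed.

Lemma relD A B N : measurable A -> measurable B -> A `&` B = set0 ->
  rel (A `|` B) N = rel A N + rel B N.
Proof.
move=> mA mB AB0; rewrite /relative_measure -mulrDl; congr (_ / _).
rewrite -fineD ?folner_fin_num// setIUl measureU//; try exact: measurableI.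
by rewrite setIACA AB0 set0I.
Qed.

Lemma rel_ge0 A N : 0 <= rel A N.
Proof. by rewrite divr_ge0// fine_ge0. Qed.

Lemma rel_le A B N : measurable A -> measurable B -> A `<=` B -> rel A N <= rel B N.
Proof.
move=> mA mB AB; rewrite -(setDUK AB) relD//; last by rewrite setDE setICA setICr setI0.
  by rewrite lerDl rel_ge0.
exact: measurableD.
Qed.

Lemma relT N : rel [set: borel G] N = 1.
Proof. by rewrite /relative_measure setTI divff// gt_eqF// fine_folner_gt0. Qed.

Lemma rel_le1 A N : measurable A -> rel A N <= 1.
Proof. by move=> mA; rewrite -(relT N); apply: rel_le. Qed.

Lemma relC A N : measurable A -> rel (~` A) N = 1 - rel A N.
Proof.
move=> mA; rewrite -(relT N) -(setUv A) relD ?setICr//; last exact: measurableC.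
by rewrite addrAC subrr add0r.
Qed.

Lemma relU_le A B N : measurable A -> measurable B ->
  rel (A `|` B) N <= rel A N + rel B N.
Proof.
move=> mA mB; have -> : A `|` B = A `|` (B `\` A).
  rewrite eqEsubset; split=> x [Ax|Bx]; [by left| |by left|by case: Bx; right].
  by have [Ax|nAx] := pselect (A x); [left|right].
have mBA : measurable (B `\` A) by exact: measurableD.
by rewrite relD// ?lerD2l ?rel_le//; rewrite setDE setICA setICr setI0.
Qed.

Lemma rel_bigU (I : choiceType) (s : seq I) (F : I -> set (borel G)) N :
  uniq s -> (forall i, measurable (F i)) ->
  (forall i j, i \in s -> j \in s -> i != j -> F i `&` F j = set0) ->
  rel (\big[setU/set0]_(i <- s) F i) N = \sum_(i <- s) rel (F i) N.
Proof.
elim: s => [|i s IH] us mF dF.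
  by rewrite !big_nil /relative_measure set0I measure0 mul0r.
move: us => /= /andP[nis us]; rewrite !big_cons relD//.
- rewrite IH// => j k js ks; by apply: dF; rewrite inE ?js ?ks orbT.
- exact: bigsetU_measurable.
- rewrite -subset0 => x [Fx]; rewrite -bigcup_seq => -[j /= js Fjx].
  have dij : F i `&` F j = set0.
    by apply: dF; rewrite ?inE ?eqxx ?js ?orbT//; apply: contraNneq nis => ->.
  by have : (F i `&` F j) x by []; rewrite dij.
Qed.

(** By invariance [A] has in [Phi N] the mass that [g A] has in [g (Phi N)]. What is lost in passing
    to [Phi N] is at most the mass of [g (Phi N)] outside [Phi N]. *)
Lemma rel_left_translate g A N : measurable A ->
  rel A N <= rel (left_translate g A) N + (1 - rel (left_translate g (Phi N)) N).
Proof.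
move=> mA; have mgA := measurable_left_translate g mA.
have mgP := measurable_left_translate g (@measurable_folner N).
have fg B : measurable B -> m (B `&` left_translate g (Phi N)) \is a fin_num.
  move=> mB; rewrite ge0_fin_numE//.
  apply: (@le_lt_trans _ _ (m (left_translate g (Phi N)))).
    by apply: le_measure => //; rewrite inE//; exact: measurableI.
  by rewrite (haar_left_invariant hm)// folner_ltey.
have relE : rel A N = fine (m (left_translate g A `&` left_translate g (Phi N)))
                        / fine (m (Phi N)).
  rewrite /relative_measure -(haar_left_invariant hm g (A := A `&` Phi N)).
    by rewrite !left_translateE preimage_setI.
  exact: measurableI.
rewrite relE -(relT N) /relative_measure setTI -mulrBl -mulrDl.
rewrite ler_wpM2r ?invr_ge0 ?fine_ge0//.
have fgP := fg _ measurableT; rewrite setTI in fgP.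
have mPg : fine (m (Phi N)) = fine (m (left_translate g (Phi N) `\` Phi N)) +
    fine (m (left_translate g (Phi N) `&` Phi N)).
  rewrite -fineD ?(folner_fin_num _ mgP)//; last by rewrite setDE setIC fg//; exact: measurableC.
  rewrite -(measureDI m mgP (@measurable_folner N)); congr fine.
  by apply/esym; exact: (haar_left_invariant hm).
rewrite mPg addrK -fineD ?(folner_fin_num _ mgA)//; last first.
  by rewrite setDE setIC fg//; exact: measurableC.
apply: fine_le.
- exact: fg.
- rewrite fin_numD (folner_fin_num _ mgA)//= setDE setIC fg//; exact: measurableC.
apply: (@le_trans _ _ (m ((left_translate g A `&` Phi N) `|`
    (left_translate g (Phi N) `\` Phi N)))); last first.
  by apply: measureU2; [exact: measurableI|exact: measurableD].
apply: le_measure; rewrite ?inE.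
- exact: measurableI.
- by apply: measurableU; [exact: measurableI|exact: measurableD].
- move=> x [gAx gPx]; have [Px|nPx] := pselect (Phi N x); first by left.
  by right.
Qed.

Lemma cvg_rel_folner g : rel (left_translate g (Phi N)) N @[N --> \oo] --> (1 : R).
Proof.
have := folner_lim hPhi (@compact_set1 _ g).
by rewrite uniform_set1 => h; apply: h.
Qed.

End RelativeMeasure.

Section FolnerTranslates.
Variables (R : realType) (G : topologicalGroupType).
Variable m : {measure set (borel G) -> \bar R}.
Variable Phi : nat -> set G.
Hypotheses (hG : hausdorff_space G) (hm : left_Haar_measure m).
Hypothesis hPhi : left_Folner m Phi.
Implicit Types A B : set (borel G).

Local Notation rel A N := (relative_measure m A (Phi N)).

(** The error depends only on the translating elements, so one threshold serves all sets [A], which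
    may vary with [i]. *)
Lemma rel_left_translate_near (I : finType) (g : I -> G) (e : R) : 0 < e ->
  \forall N \near \oo, forall i A, measurable A ->
    rel A N <= rel (left_translate (g i) A) N + e.
Proof.
move=> e0.
have : \forall N \near \oo, forall i,
    1 - rel (left_translate (g i) (Phi N)) N <= e.
  apply: filter_forall => i.
  have /cvgrPdist_le/(_ _ e0) := cvg_rel_folner hPhi (g i).
  by apply: filterS => N; apply: le_trans; exact: ler_norm.
apply: filterS => N H i A mA; apply: le_trans (rel_left_translate hG hm hPhi (g i) N mA) _.
by rewrite lerD2l.
Qed.

Lemma rel_disjoint_translates (k : nat) (g : 'I_k -> G) A (e : R) :
  measurable A -> 0 < e ->
  (forall i j, i != j -> left_translate (g i) A `&` left_translate (g j) A = set0) ->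
  \forall N \near \oo, k%:R * rel A N <= 1 + e.
Proof.
move=> mA e0 dA.
(* The [k] errors of this size add up to at most [e]; the successor covers [k = 0]. *)
have ek : 0 < e / k.+1%:R by rewrite divr_gt0.
apply: filterS (rel_left_translate_near g ek) => N H.
have mgA i := measurable_left_translate (g i) mA.
have : \sum_(i < k) rel (left_translate (g i) A) N <= 1.
  rewrite -(rel_bigU hG hm hPhi (F := fun i => left_translate (g i) A))//.
  - by apply: (rel_le1 hG hm hPhi); exact: bigsetU_measurable.
  - exact: index_enum_uniq.
  - by move=> i j _ _; exact: dA.
move=> sum1; have : \sum_(i < k) (rel A N - e / k.+1%:R) <= 1.
  by apply: le_trans sum1; apply: ler_sum => i _; rewrite lerBlDr H.
rewrite sumr_const card_ord mulrnBl lerBlDr mulr_natl => /le_trans; apply.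
rewrite lerD2l -[leLHS]mulr_natr -mulrA ger_pMr// mulrC ler_pdivrMr ?mul1r//.
by rewrite ler_nat.
Qed.

End FolnerTranslates.

(** * Invariant means *)

Section Mean.
Variables (R : realType) (G : topologicalGroupType).
Variable m : {measure set (borel G) -> \bar R}.
Variable M : (borel G -> R) -> R.
Hypothesis ML : forall (a : R) f1 f2, f1 \in Lfun m +oo%E -> f2 \in Lfun m +oo%E ->
  M (fun x => a * f1 x + f2 x) = a * M f1 + M f2.
Hypothesis Mpos : forall f, f \in Lfun m +oo%E ->
  {ae m, forall x, 0 <= f x} -> 0 <= M f.
Hypothesis M1 : M (cst 1) = 1.
Hypothesis Minv : forall g f, f \in Lfun m +oo%E -> M (fun x => f (g^-1 * x)%g) = M f.
Implicit Types A B : set (borel G).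

Lemma bounded_Lfun (f : borel G -> R) (C : R) :
  measurable_fun setT f -> (forall x, `|f x| <= C) -> f \in Lfun m +oo%E.
Proof.
move=> mf fC; apply/andP; split; rewrite inE//=; rewrite /finite_norm unlock.
case: ifP => // _; apply: (@le_lt_trans _ _ C%:E); last exact: ltry.
by apply/ess_supP; apply: aeW => x /=; rewrite lee_fin.
Qed.

Definition mean_set A : R := M (\1_A).

Lemma indic_Lfun A : measurable A -> (\1_A : borel G -> R) \in Lfun m +oo%E.
Proof.
move=> mA; apply: (@bounded_Lfun _ 1); first exact: measurable_indic.
by move=> x; rewrite indicE normr_nat lern1 leq_b1.
Qed.

Lemma mean0 : M (fun=> 0) = 0.
Proof.
have f1 : (cst 1 : borel G -> R) \in Lfun m +oo%E.
  apply: (@bounded_Lfun (cst 1) 1); first exact: measurable_cst.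
  by move=> x; rewrite normr1.
have e : -1 * M (cst 1) + M (cst 1) = 0 by rewrite mulN1r addNr.
apply: etrans e; apply: etrans (ML (-1) f1 f1).
by congr (M _); apply/funext => x /=; rewrite mulN1r addNr.
Qed.

Lemma simple_Lfun (I : Type) (s : seq I) (c : I -> R) (B : I -> set (borel G)) :
  (forall i, measurable (B i)) ->
  (fun x => \sum_(i <- s) c i * \1_(B i) x) \in Lfun m +oo%E.
Proof.
move=> mB; apply: (@bounded_Lfun _ (\sum_(i <- s) `|c i|)).
  apply: measurable_sum => i; apply: measurable_funM; first exact: measurable_cst.
  exact: measurable_indic.
move=> x; apply: le_trans (ler_norm_sum _ _ _) _; apply: ler_sum => i _.
by rewrite normrM ler_piMr// indicE normr_nat lern1 leq_b1.
Qed.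

Lemma mean_simple (I : Type) (s : seq I) (c : I -> R) (B : I -> set (borel G)) :
  (forall i, measurable (B i)) ->
  M (fun x => \sum_(i <- s) c i * \1_(B i) x) = \sum_(i <- s) c i * mean_set (B i).
Proof.
move=> mB; elim: s => [|i s IH].
  by rewrite big_nil -[RHS]mean0; congr (M _); apply/funext => x; rewrite big_nil.
rewrite big_cons -IH -ML.
- by congr (M _); apply/funext => x; rewrite big_cons.
- exact: indic_Lfun.
- exact: simple_Lfun.
Qed.

Lemma mean_simple_ge0 (I : Type) (s : seq I) (c : I -> R) (B : I -> set (borel G)) :
  (forall i, measurable (B i)) ->
  (forall x, 0 <= \sum_(i <- s) c i * \1_(B i) x) ->
  0 <= \sum_(i <- s) c i * mean_set (B i).
Proof.
move=> mB H; rewrite -mean_simple//; apply: Mpos; first exact: simple_Lfun.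
exact: aeW.
Qed.

Lemma mean_setT : mean_set setT = 1.
Proof. by rewrite /mean_set indicT. Qed.

Lemma mean_set_ge0 A : measurable A -> 0 <= mean_set A.
Proof.
move=> mA; apply: Mpos; first exact: indic_Lfun.
by apply: aeW => x; rewrite indicE.
Qed.

Lemma mean_setU A B : measurable A -> measurable B -> A `&` B = set0 ->
  mean_set (A `|` B) = mean_set A + mean_set B.
Proof.
move=> mA mB AB0; rewrite -[mean_set A]mul1r /mean_set -ML; try exact: indic_Lfun.
congr (M _); apply/funext => x; rewrite mul1r !indicE in_setU.
have : x \notin A `&` B by rewrite AB0 in_set0.
by rewrite in_setI; case: (x \in A); case: (x \in B) => //; rewrite ?addr0 ?add0r.
Qed.

Lemma mean_set_translate g A : measurable A ->
  mean_set (left_translate g A) = mean_set A.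
Proof.
move=> mA; rewrite /mean_set -[RHS](Minv g); last exact: indic_Lfun.
by congr (M _); apply/funext => x; rewrite left_translateE !indicE.
Qed.

Lemma mean_simple_ge (I : finType) (c : I -> R) (B : I -> set (borel G)) (a : R) :
  (forall i, measurable (B i)) -> (forall x, a <= \sum_i c i * \1_(B i) x) ->
  a <= \sum_i c i * mean_set (B i).
Proof.
(* The index [None] carries the constant [- a] on the whole group, which turns the lower bound into
   positivity of a simple function. *)
move=> mB H; pose s := None :: [seq Some i | i <- index_enum I].
pose c' o := if o is Some i then c i else - a.
pose B' o := if o is Some i then B i else setT.
have : 0 <= \sum_(o <- s) c' o * mean_set (B' o).
  apply: mean_simple_ge0; first by case=> [i|]; [exact: mB|exact: measurableT].
  move=> x; by rewrite /s big_cons big_map /= indicT mulr1 addrC subr_ge0.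
by rewrite /s big_cons big_map /= mean_setT mulr1 addrC subr_ge0.
Qed.

Lemma mean_simple_le (I : finType) (c : I -> R) (B : I -> set (borel G)) (b : R) :
  (forall i, measurable (B i)) -> (forall x, \sum_i c i * \1_(B i) x <= b) ->
  \sum_i c i * mean_set (B i) <= b.
Proof.
move=> mB H; rewrite -lerN2 -sumrN.
under eq_bigr do rewrite -mulNr.
apply: mean_simple_ge => // x.
by under eq_bigr do rewrite mulNr; rewrite sumrN lerN2.
Qed.

End Mean.

(** * Almost periodic filtrations *)

(* [D t] plays the role of the sublevel set [{h < t}] of an almost periodic
   function [h]; the finite measurable colouring expresses that the two-sided
   translates of [h] are totally bounded. *)
Record ap_filtration (R : realType) (G : topologicalGroupType) (D : R -> set G) : Prop := {
  apf_open : forall t, open (D t) ;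
  apf_colouring : forall e : R, 0 < e -> exists (I : finType) (c : G -> I),
    (forall i, measurable (c @^-1` [set i] : set (borel G))) /\
    forall a x y b t, c x = c y -> D t (a * x * b)%g -> D (t + e) (a * y * b)%g
}.

Section APFiltration.
Variables (R : realType) (G : topologicalGroupType).

Lemma ap_filtrationU (D1 D2 : R -> set G) : ap_filtration D1 -> ap_filtration D2 ->
  ap_filtration (fun t => D1 t `|` D2 t).
Proof.
move=> h1 h2; split=> [t|e e0].
  by apply: openU; [exact: apf_open h1 t|exact: apf_open h2 t].
have [I1 [c1 [m1 H1]]] := apf_colouring h1 e0.
have [I2 [c2 [m2 H2]]] := apf_colouring h2 e0.
exists (I1 * I2)%type, (fun x => (c1 x, c2 x)); split=> [[i j]|a x y b t [? ?]].
  have -> : (fun x => (c1 x, c2 x)) @^-1` [set (i, j)] =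
      (c1 @^-1` [set i]) `&` (c2 @^-1` [set j]).
    by rewrite eqEsubset; split=> x [] /= -> ->.
  exact: (@measurableI _ (borel G)).
by case=> Dx; [left; apply: H1 Dx|right; apply: H2 Dx].
Qed.

Lemma ap_filtration_bigU (D : nat -> R -> set G) n :
  (forall k, ap_filtration (D k)) ->
  ap_filtration (fun t => \big[setU/set0]_(k < n) D k t).
Proof.
move=> hD; elim: n => [|n IH].
  have -> : (fun t => \big[setU/set0]_(k < 0) D k t) = (fun t : R => set0).
    by apply/funext => t; rewrite big_ord0.
  split=> [t|e e0]; first exact: open0.
  exists unit, (fun=> tt); split=> // i; have -> : (fun=> tt) @^-1` [set i] = [set: G].
    by rewrite eqEsubset; split=> // x _ /=; case: i.
  exact: (@measurableT _ (borel G)).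
have -> : (fun t => \big[setU/set0]_(k < n.+1) D k t) =
    (fun t => (\big[setU/set0]_(k < n) D k t) `|` D n t).
  by apply/funext => t; rewrite big_ord_recr.
exact: ap_filtrationU.
Qed.

(** Rescaling puts Bohr sets of different radii on one scale, so that a single parameter can be
    chosen for all of them. *)
Lemma ap_filtration_scale (D : R -> set G) (r : R) : 0 < r ->
  ap_filtration D -> ap_filtration (fun t => D (t * r)).
Proof.
move=> r0 hD; split=> [t|e e0]; first exact: apf_open hD _.
have [I [c [mc H]]] := apf_colouring hD (mulr_gt0 e0 r0).
by exists I, c; split=> // a x y b t cxy Dx; rewrite mulrDl; exact: H Dx.
Qed.

End APFiltration.

Section APDensity.
Variables (R : realType) (G : topologicalGroupType).
Variable m : {measure set (borel G) -> \bar R}.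
Variable Phi : nat -> set G.
Hypotheses (hG : hausdorff_space G) (hm : left_Haar_measure m).
Hypothesis hPhi : left_Folner m Phi.
Hypothesis am : amenable m.

Local Notation rel A N := (relative_measure m A (Phi N)).

Lemma rel_colouring (I : finType) (c : G -> I) (A : set (borel G)) N :
  (forall i, measurable (c @^-1` [set i] : set (borel G))) -> measurable A ->
  rel A N = \sum_i rel (A `&` (c @^-1` [set i])) N.
Proof.
move=> mc mA.
rewrite -(rel_bigU hG hm hPhi (F := fun i => A `&` (c @^-1` [set i]))).
- congr relative_measure; rewrite -bigcup_seq eqEsubset; split=> x.
    by move=> Ax; exists (c x) => //=; rewrite mem_index_enum.
  by case=> i _ [].
- exact: index_enum_uniq.
- by move=> i; exact: measurableI.
- move=> i j _ _ ij; rewrite -subset0 => x [[_ /= cx] [_ /= cx']].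
  by move: ij; rewrite -cx -cx' eqxx.
Qed.

(* Averaging over [x] the (nearly constant) relative measures of the translates
   [x D_t] and exchanging the two averages via the colour classes compares both
   sides with the mean of [D_t^-1], for an intermediate [t]. *)
Lemma rel_ap_filtration (D : R -> set G) (s t e : R) :
  ap_filtration D -> s < t -> 0 < e -> \forall n \near \oo, forall p q,
    (n <= p)%N -> (n <= q)%N -> rel (D s) p <= rel (D t) q + e.
Proof.
move=> hD st e0; have [M [ML Mpos M1 Minv]] := am.
(* Two replacements of a point by the representative of its colour lead from [s] to [w], and two
   more from [w] to [t]. *)
pose eta := (t - s) / 4; have eta0 : 0 < eta by rewrite divr_gt0// subr_gt0.
pose w := s + eta + eta.
have wt : t = w + eta + eta by rewrite /w /eta; lra.
have [I [c [mc H]]] := apf_colouring hD eta0.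
(* [z i] is a point of colour [i]; the default [1] matters only for colours that do not occur. *)
have [z zP] : exists z : I -> G, forall x, c (z (c x)) = c x.
  exists (fun i => xget 1%g (c @^-1` [set i])) => x.
  exact: (@xgetPex _ 1%g (c @^-1` [set c x]) (ex_intro _ x erefl)).
have mD u : measurable (D u : set (borel G)) by apply: open_borel; exact: (apf_open hD).
have e2 : 0 < e / 2 by rewrite divr_gt0.
pose V x u : set (borel G) := [set y | D u (x^-1 * y)%g].
have mV x u : measurable (V x u).
  by apply: continuous_borel (mD u); exact: mulg_continuousl.
(* The point [x] lies in [B j] exactly when [x^-1 z_j] lies in [D w]. All [B j] are left translates
   of [P] and so have the same mean, whatever weights the colours receive in [Phi N]. *)
pose P : set (borel G) := [set x | D w (x^-1)%g].
have mP : measurable P by apply: continuous_borel (mD w); exact: invg_continuous.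
pose B j : set (borel G) := left_translate (z j) P.
have BE j x : B j x = D w (x^-1 * z j)%g.
  by rewrite /B left_translateE /P/= invgM invgK.
have mB j : measurable (B j) by exact: measurable_left_translate.
have muB j : mean_set M (B j) = mean_set M P by apply: mean_set_translate Minv _ _ _.
have sumP N : \sum_j rel (c @^-1` [set j]) N = 1.
  rewrite -(relT hm hPhi N) (rel_colouring _ mc measurableT).
  by apply: eq_bigr => j _; rewrite setTI.
have sumB N : \sum_j rel (c @^-1` [set j]) N * mean_set M (B j) = mean_set M P.
  by under eq_bigr do rewrite muB; rewrite -mulr_suml sumP mul1r.
have [n1 _ h1] := rel_left_translate_near hG hm hPhi (fun i => (z i)^-1%g) e2.
have [n2 _ h2] := rel_left_translate_near hG hm hPhi z e2.
have Dz x y u : D u (x * y)%g -> D (u + eta) (z (c x) * y)%g.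
  by have := H 1%g x (z (c x)) y u; rewrite !mul1g zP; exact.
have zD x y u : D u (z (c x) * y)%g -> D (u + eta) (x * y)%g.
  by have := H 1%g (z (c x)) x y u; rewrite !mul1g zP; exact.
have Dz' x y u : D u (x * y)%g -> D (u + eta) (x * z (c y))%g.
  by have := H x y (z (c y)) 1%g u; rewrite !mulg1 zP; exact.
have zD' x y u : D u (x * z (c y))%g -> D (u + eta) (x * y)%g.
  by have := H x (z (c y)) y 1%g u; rewrite !mulg1 zP; exact.
(* For each [x], [D s] is compared with [V x (s + eta)], the translate of [D (s + eta)] by [x],
   which meets only colours [j] with [x] in [B j]. This bounds [rel (D s) N] by a simple function of
   [x], whose mean is that of [P]. For [lower], conversely, those colour classes lie in
   [V x (w + eta)]. *)
have upper N : (n1 <= N)%N -> rel (D s) N <= mean_set M P + e / 2.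
  move=> nN; rewrite -lerBlDr -(sumB N); apply: mean_simple_ge ML Mpos M1 _ _ _ _ _ _ => // x.
  rewrite lerBlDr; apply: le_trans (h1 N nN (c x^-1%g) _ (mD s)) _; rewrite lerD2r.
  apply: (@le_trans _ _ (rel (V x (s + eta)) N)).
    apply: (rel_le hG hm hPhi) => //; first exact: measurable_left_translate.
    by move=> y; rewrite left_translateE/= invgK; exact: zD.
  rewrite (rel_colouring _ mc)//; apply: ler_sum => j _; rewrite indicE.
  have [xBj|/negP xBj] := boolP (x \in B j).
    by rewrite mulr1; apply: (rel_le hG hm hPhi) => //; exact: measurableI.
  rewrite mulr0; have -> : V x (s + eta) `&` c @^-1` [set j] = set0.
    rewrite -subset0 => y [/= Vy cy]; apply: xBj; rewrite inE BE -cy.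
    exact: Dz'.
  by rewrite /relative_measure set0I measure0 mul0r.
have lower N : (n2 <= N)%N -> mean_set M P <= rel (D t) N + e / 2.
  move=> nN; rewrite -(sumB N); apply: mean_simple_le ML Mpos M1 _ _ _ _ _ _ => // x.
  pose W := left_translate (z (c x^-1%g))^-1%g (D t) : set (borel G).
  have mW : measurable W by exact: measurable_left_translate.
  apply: (@le_trans _ _ (rel W N)); last first.
    apply: le_trans (h2 N nN (c x^-1%g) _ mW) _; rewrite lerD2r.
    have -> // : left_translate (z (c x^-1%g)) W = D t.
    by rewrite /W !left_translateE invgK -comp_preimage; apply/seteqP; split=> y /=;
      rewrite mulVKg.
  apply: (@le_trans _ _ (rel (V x (w + eta)) N)); last first.
    apply: (rel_le hG hm hPhi) => // y; rewrite /W left_translateE/= invgK wt.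
    exact: Dz.
  rewrite (rel_colouring _ mc)//; apply: ler_sum => j _; rewrite indicE.
  have [|/negP xBj] := boolP (x \in B j); last by rewrite mulr0 rel_ge0.
  rewrite mulr1 inE BE => xBj; apply: (rel_le hG hm hPhi) => //; first exact: measurableI.
  by move=> y /= cy; split=> //=; apply: zD'; rewrite cy.
exists (maxn n1 n2) => // n; rewrite /= geq_max => /andP[n1n n2n] p q np nq.
have := upper _ (leq_trans n1n np); have := lower _ (leq_trans n2n nq); lra.
Qed.

Lemma countable_nonconvergence (D : R -> set G) : ap_filtration D ->
  countable [set t | ~ has_density m Phi (D t)].
Proof.
move=> hD; apply: cvg_off_countable => [t n|s t e st e0].
  rewrite rel_ge0/= (rel_le1 hG hm hPhi)//.
  by apply: open_borel; exact: (apf_open hD).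
exact: rel_ap_filtration.
Qed.

End APDensity.

(** * Bounded matrix representations *)

Section CompactInduction.
Variable T : topologicalType.

(** If [P K] failed, the sets [A] such that [P] holds for the part of [K] outside [A] would form a
    proper filter containing [K]. The local hypothesis at a cluster point of it in [K] gives a
    contradiction. *)
Lemma compact_induction (P : set T -> Prop) (K : set T) : compact K ->
  P set0 -> (forall A B, A `<=` B -> P B -> P A) ->
  (forall A B, P A -> P B -> P (A `|` B)) ->
  (forall x, K x -> exists2 V, nbhs x V & P (K `&` V)) -> P K.
Proof.
move=> cK P0 Psub PU Ploc; apply: contrapT => nPK.
pose F : set_system T := [set A | P (K `\` A)].
have FF : ProperFilter F.
  split=> [|]; first by rewrite /F /= setD0.
  split=> [|A B FA FB|A B AB]; rewrite /F /=.
  - by rewrite setDT.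
  - by rewrite setDIr; exact: PU.
  - by apply: Psub; exact: setDS.
have FK : F K by rewrite /F /= setDv.
have [x [Kx clx]] := cK F FF FK.
have [V xV PV] := Ploc x Kx.
have FV : F (~` V) by rewrite /F /= setDE setCK.
by have [y []] := clx _ _ FV xV.
Qed.

End CompactInduction.

Section MatrixNorm.
Variable R : realType.

Lemma ler_mx_coord m n (A : 'M[R]_(m, n)) i j : `|A i j| <= `|A|.
Proof.
by rewrite [leRHS]/Num.Def.normr /= mx_normrE; apply/bigmax_geP; right; exists (i, j).
Qed.

Lemma mx_norm_le m n (A : 'M[R]_(m, n)) (x : R) : 0 <= x ->
  (forall i j, `|A i j| <= x) -> `|A| <= x.
Proof.
move=> x0 Ax; rewrite [leLHS]/Num.Def.normr /= mx_normrE; apply/bigmax_leP.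
by split=> // -[i j] _; exact: Ax.
Qed.

Lemma mx_norm_lt m n (A : 'M[R]_(m, n)) (x : R) : 0 < x ->
  (forall i j, `|A i j| < x) -> `|A| < x.
Proof.
move=> x0 Ax; rewrite [ltLHS]/Num.Def.normr /= mx_normrE; apply/bigmax_ltP.
by split=> // -[i j] _; exact: Ax.
Qed.

(** The norm is the largest absolute value of an entry, hence the dimension factor here and in all
    later radii. *)
Lemma mx_norm_mul m n p (A : 'M[R]_(m, n)) (B : 'M[R]_(n, p)) :
  `|A *m B| <= n%:R * `|A| * `|B|.
Proof.
apply: mx_norm_le => [|i j]; first by rewrite !mulr_ge0.
rewrite mxE; apply: le_trans (ler_norm_sum _ _ _) _.
apply: (@le_trans _ _ (\sum_(k < n) (`|A| * `|B|))).
  by apply: ler_sum => k _; rewrite normrM ler_pM ?ler_mx_coord.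
by rewrite sumr_const card_ord -mulrA mulr_natl.
Qed.

Lemma mx_continuous (T : topologicalType) m n (f : T -> 'M[R]_(m, n)) :
  (forall i j, continuous (fun x => f x i j)) -> continuous f.
Proof.
move=> cf x A [P Pf PA]; rewrite /nbhs /=.
suff : \forall y \near x, forall i j, P i j (f y i j).
  by apply: filterS => y; exact: PA.
apply: filter_forall => i; apply: filter_forall => j.
exact: cf.
Qed.

Lemma block_mx_norm m n p q (A : 'M[R]_(m, n)) (B : 'M[R]_(p, q)) :
  `|A| <= `|block_mx A 0 0 B| /\ `|B| <= `|block_mx A 0 0 B|.
Proof.
split; apply: mx_norm_le => // i j.
  by rewrite -(block_mxEul A 0 0 B) ler_mx_coord.
by rewrite -(block_mxEdr A 0 0 B) ler_mx_coord.
Qed.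

End MatrixNorm.

(** Of unitarity only a bound on the entries is kept. It makes the image totally bounded, and
    translations on either side Lipschitz with constant [N]. *)
Record bounded_rep (R : realType) (G : topologicalGroupType) (N : nat)
    (r : G -> 'M[R]_N) : Prop := {
  brep1 : r 1%g = 1%:M ;
  brepM : forall g h, r (g * h)%g = r g *m r h ;
  brep_le1 : forall g, `|r g| <= 1 ;
  brep_coord_continuous : forall i j, continuous (fun g => r g i j) }.

Section BoundedRep.
Variables (R : realType) (G : topologicalGroupType).

Lemma brep_continuous N (r : G -> 'M[R]_N) : bounded_rep r -> continuous r.
Proof. by move=> hr; apply: mx_continuous; exact: brep_coord_continuous hr. Qed.

Section Distance.
Variables (N : nat) (r : G -> 'M[R]_N).
Hypothesis hr : bounded_rep r.

Lemma brep_distl g x y : `|r (g * x)%g - r (g * y)%g| <= N%:R * `|r x - r y|.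
Proof.
rewrite !(brepM hr) -mulmxBr; apply: le_trans (mx_norm_mul _ _) _.
by rewrite -mulrA ler_wpM2l// ler_piMl// (brep_le1 hr).
Qed.

Lemma brep_distr g x y : `|r (x * g)%g - r (y * g)%g| <= N%:R * `|r x - r y|.
Proof.
rewrite !(brepM hr) -mulmxBl; apply: le_trans (mx_norm_mul _ _) _.
by rewrite ler_piMr ?(brep_le1 hr)// mulr_ge0.
Qed.

Lemma brep_dist_open (x : G) (t : R) : open [set g | `|r x - r g| < t].
Proof.
have -> : [set g | `|r x - r g| < t] = (fun g => `|r x - r g|) @^-1` [set y | y < t] by [].
apply: open_comp; last exact: open_lt.
move=> g _; apply: (@cvg_norm _ _ _ _ (nbhs_filter g)).
by apply: cvgB; [exact: cvg_cst|exact: brep_continuous].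
Qed.

(** The interval [-1, 1], which contains all entries, is cut into cells of length [1/k] with
    [1/k < e]; the colour records the cell of every entry. *)
Lemma brep_colouring (e : R) : 0 < e -> exists (I : finType) (c : G -> I),
  (forall i, measurable (c @^-1` [set i] : set (borel G))) /\
  forall x y, c x = c y -> `|r x - r y| < e.
Proof.
move=> e0; pose k := (Num.truncn e^-1).+1.
have ek : e^-1 < k%:R by apply: real_truncnS_gt; exact: num_real.
have k0 : 0 < (k%:R : R) by rewrite ltr0n.
(* Adding 1 makes the entries nonnegative, as [Num.truncn] requires. The truncations range from 0 to
   [2 * k], the endpoint being attained at the entry 1. *)
pose f x i j : R := (r x i j + 1) * k%:R.
have rij x i j : `|r x i j| <= 1 by apply: le_trans (ler_mx_coord _ _ _) (brep_le1 hr x).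
have f0 x i j : 0 <= f x i j.
  by rewrite mulr_ge0// -lerBlDr sub0r; have := rij x i j; rewrite ler_norml => /andP[].
have fk x i j : (Num.truncn (f x i j) < (2 * k).+1)%N.
  rewrite ltnS -(ler_nat R); apply: le_trans (proj1 (andP (truncn_itv (f0 x i j)))) _.
  rewrite natrM ler_wpM2r//; have := rij x i j; rewrite ler_norml; lra.
pose c x : {ffun 'I_N * 'I_N -> 'I_(2 * k).+1} :=
  [ffun ij => inord (Num.truncn (f x ij.1 ij.2))].
exists {ffun 'I_N * 'I_N -> 'I_(2 * k).+1}, c; split=> [u|x y cxy].
  have -> : c @^-1` [set u] = \bigcap_(ij in [set: 'I_N * 'I_N])
      ([set x | (u ij)%:R <= f x ij.1 ij.2] `&` [set x | f x ij.1 ij.2 < (u ij).+1%:R]).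
    rewrite eqEsubset; split=> [x /= <- ij _ /=|x H /=].
      rewrite ffunE inordK//; apply/andP; exact: truncn_itv.
    apply/ffunP => ij; apply/val_inj; rewrite /= ffunE inordK//.
    by have /andP := H ij I; rewrite -truncn_eq// => /eqP.
  apply: (@fin_bigcap_measurable _ (borel G)) => [|ij _]; first exact: finite_finset.
  have cf : continuous (fun x => f x ij.1 ij.2).
    move=> x; apply: cvgM; last exact: cvg_cst.
    by apply: cvgD; [exact: brep_coord_continuous hr _ _ _|exact: cvg_cst].
  apply: (@measurableI _ (borel G)).
    apply: closed_borel; apply: (@closed_comp _ _ (fun x => f x ij.1 ij.2) [set y | _ <= y]).
      by move=> x _; exact: cf.
    exact: closed_ge.
  apply: open_borel; apply: (@open_comp _ _ (fun x => f x ij.1 ij.2) [set y | y < _]).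
    by move=> x _; exact: cf.
  exact: open_lt.
apply: mx_norm_lt => // i j; rewrite !mxE.
have txy : Num.truncn (f x i j) = Num.truncn (f y i j).
  move/ffunP : cxy => /(_ (i, j)); rewrite !ffunE => /(congr1 val) /=.
  by rewrite !inordK.
have := truncn_itv (f0 x i j); rewrite txy => /andP[lx ux].
have /andP[ly uy] := truncn_itv (f0 y i j).
have : `|f x i j - f y i j| < 1.
  by rewrite ltr_distlC; move: lx ux ly uy; rewrite -natr1; lra.
rewrite /f -mulrBl opprD addrACA subrr addr0 normrM (ger0_norm (ltW k0)).
rewrite -ltr_pdivlMr// => /lt_trans; apply.
by rewrite mul1r -[ltRHS]invrK ltf_pV2// posrE invr_gt0.
Qed.

(** A two-sided translation expands [r]-distances by a factor at most [N * N], so a colouring fine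
    enough to absorb this factor works for all translates. *)
Lemma brep_filtration (Q : set G) :
  ap_filtration (fun t => [set g | exists2 q, Q q & `|r q - r g| < t]).
Proof.
split=> [t|e e0].
  have -> : [set g | exists2 q, Q q & `|r q - r g| < t] =
      \bigcup_(q in Q) [set g | `|r q - r g| < t].
    by rewrite eqEsubset; split=> g [q Qq qg]; exists q.
  by apply: bigcup_open => q _; exact: brep_dist_open.
have N0 : 0 < (N.+1%:R * N.+1%:R : R) by rewrite mulr_gt0.
have [I [c [mc H]]] := brep_colouring (divr_gt0 e0 N0).
exists I, c; split=> // a x y b t cxy [q Qq qt]; exists q => //.
rewrite -(subrKA (r (a * x * b)%g)); apply: le_lt_trans (ler_normD _ _) _.
apply: ltr_leD => //; apply: le_trans (brep_distr _ _ _) _.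
apply: (@le_trans _ _ (N%:R * (N%:R * `|r x - r y|))).
  by rewrite ler_wpM2l// brep_distl.
rewrite mulrA; apply: (@le_trans _ _ (N.+1%:R * N.+1%:R * `|r x - r y|)).
  by rewrite ler_wpM2r// ler_pM// ler_nat.
by rewrite mulrC -ler_pdivlMr// ltW// H.
Qed.

End Distance.

Lemma brep_block N1 N2 (r1 : G -> 'M[R]_N1) (r2 : G -> 'M[R]_N2) :
  bounded_rep r1 -> bounded_rep r2 -> bounded_rep (fun g => block_mx (r1 g) 0 0 (r2 g)).
Proof.
move=> h1 h2; split=> [|g h|g|i j].
- by rewrite (brep1 h1) (brep1 h2) -scalar_mx_block.
- by rewrite mulmx_block !mul0mx !mulmx0 !addr0 !add0r (brepM h1) (brepM h2).
- apply: mx_norm_le => // i j; rewrite -(splitK i) -(splitK j).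
  case: (fintype.split i) => i'; case: (fintype.split j) => j' /=;
    rewrite ?block_mxEul ?block_mxEur ?block_mxEdl ?block_mxEdr ?mxE ?normr0//.
    by apply: le_trans (ler_mx_coord _ _ _) (brep_le1 h1 g).
  by apply: le_trans (ler_mx_coord _ _ _) (brep_le1 h2 g).
- rewrite -(splitK i) -(splitK j).
  case: (fintype.split i) => i'; case: (fintype.split j) => j' /=.
  + under eq_fun do rewrite block_mxEul; exact: brep_coord_continuous h1 _ _.
  + under eq_fun do rewrite block_mxEur mxE; exact: cst_continuous.
  + under eq_fun do rewrite block_mxEdl mxE; exact: cst_continuous.
  + under eq_fun do rewrite block_mxEdr; exact: brep_coord_continuous h2 _ _.
Qed.

Definition rep_separated (W : set (G * G)) := exists N (r : G -> 'M[R]_N),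
  bounded_rep r /\ exists2 e : R, 0 < e & forall x y, W (x, y) -> e <= `|r x - r y|.

(** The direct sum of the two representations separates both sets, at the smaller of the two
    distances. *)
Lemma rep_separatedU A B : rep_separated A -> rep_separated B -> rep_separated (A `|` B).
Proof.
move=> [N1 [r1 [h1 [e1 e10 H1]]]] [N2 [r2 [h2 [e2 e20 H2]]]].
exists (N1 + N2)%N, (fun g => block_mx (r1 g) 0 0 (r2 g)); split; first exact: brep_block.
exists (Num.min e1 e2) => [|x y]; first by rewrite lt_min e10.
rewrite opp_block_mx add_block_mx !oppr0 !addr0.
have [n1 n2] := block_mx_norm (r1 x - r1 y) (r2 x - r2 y).
case=> [/H1|/H2] He; rewrite ge_min.
  by rewrite (le_trans He n1).
by rewrite (le_trans He n2) orbT.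
Qed.

(** Near a pair separated by [r], the distance stays above half its value by continuity; direct sums
    combine finitely many such neighbourhoods. *)
Lemma compact_rep_separated (W : set (G * G)) : compact W ->
  (forall x y, W (x, y) -> exists N (r : G -> 'M[R]_N), bounded_rep r /\ r x <> r y) ->
  rep_separated W.
Proof.
move=> cW HW; apply: compact_induction cW _ _ rep_separatedU _.
- exists 0%N, (fun=> 0); split; first split=> //.
  + by apply/matrixP => -[].
  + by move=> g h; apply/matrixP => -[].
  + by move=> g; rewrite normr0.
  + by case.
  by exists 1.
- move=> A B AB [N [r [hr [e e0 He]]]]; exists N, r; split=> //; exists e => // x y /AB.
  exact: He.
- move=> [x y] /HW[N [r [hr /eqP rxy]]].
  pose e := `|r x - r y| / 2.
  have exy : e < `|r x - r y|.
    by rewrite ltr_pdivrMr// ltr_pMr ?ltr1n// normr_gt0 subr_eq0.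
  exists [set p : G * G | e < `|r p.1 - r p.2|]; last first.
    exists N, r; split=> //; exists e; last by move=> x' y' [_ /= /ltW].
    by rewrite divr_gt0// normr_gt0 subr_eq0.
  have : open_nbhs `|r x - r y| [set z : R | e < z] by split=> //; exact: open_gt.
  move=> /open_nbhs_nbhs; apply: (_ : continuous_at (x, y) (fun p : G * G => `|r p.1 - r p.2|)).
  apply: (@cvg_norm _ _ _ _ (nbhs_filter (x, y))); apply: cvgB.
    apply: (@continuous_comp _ _ _ (@fst G G) r); first exact: cvg_fst.
    exact: brep_continuous.
  apply: (@continuous_comp _ _ _ (@snd G G) r); first exact: cvg_snd.
  exact: brep_continuous.
Qed.

End BoundedRep.

(** * Translates that are disjoint modulo the von Neumann kernel *)

Section DisjointTranslates.
Variables (R : realType) (G : topologicalGroupType).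
Local Open Scope quotient_scope.
Hypothesis ncQ : ~ compact [set: von_neumann_quotient R G].

(** Translates are added one at a time. If no further [h] were possible, every coset would meet the
    union [W] of the finitely many compact sets [g_i Q Q^-1], and the quotient would be the image of
    a compact set. *)
Lemma disjoint_translates (Q : set G) (k : nat) : compact Q ->
  exists g : nat -> G, forall i j, (i < k)%N -> (j < k)%N -> i != j ->
    forall q q', Q q -> Q q' -> ~~ coset_eq R (g i * q)%g (g j * q')%g.
Proof.
move=> cQ; elim: k => [|k [g gP]]; first by exists (fun=> 1%g).
suff [h hP] : exists h, forall i, (i < k)%N -> forall q q', Q q -> Q q' ->
    ~~ coset_eq R (g i * q)%g (h * q')%g.
  exists (fun i => if i == k then h else g i) => i j; rewrite !ltnS.
  rewrite leq_eqVlt => /predU1P[->|ik]; rewrite leq_eqVlt => /predU1P[->|jk];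
    rewrite ?eqxx ?(ltn_eqF ik) ?(ltn_eqF jk) => // ij q q' Qq Qq'.
  - by rewrite coset_eq_sym; exact: hP.
  - exact: hP.
  - exact: gP.
apply: contrapT => /forallNP H; apply: ncQ.
pose QV := (fun p : G * G => (p.1 * p.2^-1)%g) @` (Q `*` Q).
have cQV : compact QV.
  apply: continuous_compact; last exact: compact_setX.
  apply: continuous_subspaceT => p.
  apply: (@continuous_comp _ _ _ (fun p : G * G => (p.1, p.2^-1%g))
    (fun p : G * G => (p.1 * p.2)%g)); last exact: mulg_continuous.
  apply: cvg_pair; first exact: cvg_fst.
  by apply: (@continuous_comp _ _ _ (@snd G G) (fun x : G => x^-1%g)); [exact: cvg_snd|exact: invg_continuous].
pose W := \big[setU/set0]_(i < k) ((fun x => (g i * x)%g) @` QV).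
have cW : compact W.
  apply: bigsetU_compact => i _; apply: continuous_compact => //.
  by apply: continuous_subspaceT; exact: mulg_continuousl.
pose pi : G -> von_neumann_quotient R G := \pi_(von_neumann_quotient R G).
have -> : [set: von_neumann_quotient R G] = pi @` W.
  rewrite eqEsubset; split=> // y _.
  have /existsNP[l /not_implyP[lk /existsNP[q /existsNP[q']]]] := H (repr y).
  move=> /not_implyP[Qq /not_implyP[Qq' /negP/negPn cq]].
  exists (g l * (q * q'^-1))%g.
    rewrite /W -(bigcup_mkord k (fun i => (fun x => (g i * x)%g) @` QV)).
    by exists l => //; exists (q * q'^-1)%g => //; exists (q, q').
  (* Within each representation, [rho (g_l q) = rho (y q')] gives [rho (g_l q q'^-1) = rho y], where
     [y] also denotes its representative. *)
  rewrite -[RHS]reprK; apply/eqmodP => /=; apply/asboolP => V dot rho rhoP.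
  have rq a b : rho (a^-1 * b)%g = \1%VF <-> rho a = rho b.
    split=> [e|e]; last by rewrite (repr_mul rhoP) -e -(repr_mul rhoP) mulVg (repr_one rhoP).
    by rewrite -[b](mulVKg a) (repr_mul rhoP) e comp_lfun1r.
  apply/rq; rewrite mulgA; move: cq => /asboolP/(_ _ _ _ rhoP)/rq e.
  by rewrite (repr_mul rhoP) e -(repr_mul rhoP) mulgK.
by apply: continuous_compact => //; apply: continuous_subspaceT; exact: pi_continuous.
Qed.

End DisjointTranslates.

(** * From unitary to real matrix representations *)

Section UnitaryToBounded.
Variables (R : realType) (V : vectType R[i]).
Variable dot : {dot V for (@Num.conj R[i])}.

(** An orthonormal family of maximal length is taken: a nonzero remainder of some [v], once
    normalised, would extend it. *)
Lemma orthonormal_expansion : exists2 S : seq V, orthonormal dot S &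
  forall v, v = \sum_(e <- S) dot v e *: e.
Proof.
pose P k := `[< exists2 S : seq V, orthonormal dot S & size S = k >].
have P0 : exists k, P k by exists 0%N; apply/asboolP; exists [::].
have Ple k : P k -> (k <= \dim {:V})%N.
  move=> /asboolP[S /orthonormal_free fS <-].
  by rewrite -(eqP fS) dimvS// subvf.
case: (ex_maxnP P0 Ple) => k /asboolP[S oS <-] maxS; exists S => // v.
have /orthonormalP[uS dS] := oS.
apply/eqP; rewrite -subr_eq0; apply: contraT => w0.
set w := v - _ in w0.
have wS e : e \in S -> dot w e = 0.
  move=> eS; rewrite linearBl linear_sumlz/= (bigD1_seq e)//= linearZl_LR/= (dS e e)// eqxx mulr1.
  rewrite big1_seq ?addr0 ?subrr// => e' /andP[e'e e'S].
  by rewrite linearZl_LR/= (dS e' e)// (negbTE e'e) mulr0.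
have ww : 0 < dot w w by rewrite dnorm_gt0.
pose w1 := (sqrtC (dot w w))^-1 *: w.
have : P (size S).+1.
  apply/asboolP; exists (w1 :: S) => //; move: oS; rewrite /orthonormal/=.
  move=> /andP[-> ->]; rewrite !andbT; apply/andP; split.
    rewrite dnormZ normfV ger0_norm ?sqrtC_ge0 ?ltW// exprVn sqrtCK mulVf//.
    by rewrite gt_eqF.
  by apply/allP => e eS; rewrite inE /w1 linearZl_LR/= (wS _ eS) mulr0.
by move=> /maxS; rewrite ltnn.
Qed.

(** This is the inner product of the underlying real vector space, on which unitary maps act
    orthogonally and so have real matrices. *)
Definition redot (u v : V) : R := complex.Re (dot u v).

Lemma redotC u v : redot u v = redot v u.
Proof. by rewrite /redot hermC/= expr0 mul1r; case: (dot v u). Qed.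

Lemma redotDl u v w : redot (u + v) w = redot u w + redot v w.
Proof. by rewrite /redot linearDl/=; case: (dot u w); case: (dot v w). Qed.

Lemma redotNl u w : redot (- u) w = - redot u w.
Proof. by rewrite /redot linearNl/=; case: (dot u w). Qed.

Lemma redot_norm_gt0 u : u != 0 -> 0 < redot u u.
Proof.
rewrite -(dnorm_gt0 dot) /redot; case: (dot u u) => a b.
by rewrite ltcE/= => /andP[].
Qed.

(** An orthonormal family [e_k] spanning over the complex numbers yields the real orthonormal basis
    of all [e_k] and [i e_k]. The expansion takes the form of Parseval's identity. *)
Lemma redot_basis : exists N (f : 'I_N -> V),
  (forall a b, redot (f a) (f b) = (a == b)%:R) /\
  forall u v, redot u v = \sum_a redot u (f a) * redot (f a) v.
Proof.
have [S /orthonormalP[uS dS] HS] := orthonormal_expansion.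
pose e := tnth (in_tuple S).
have de k l : dot (e k) (e l) = (k == l)%:R.
  have /tuple_uniqP/inj_eq eS : uniq (in_tuple S) by [].
  by rewrite (dS _ _ (mem_tnth _ (in_tuple S)) (mem_tnth _ (in_tuple S))) eS.
exists (size S + size S)%N, (fun a => match fintype.split a with
  inl k => e k | inr k => 'i *: e k end); split=> [a b|u v].
  rewrite -(splitK a) -(splitK b) !unsplitK /redot.
  case: (fintype.split a) => k; case: (fintype.split b) => l /=;
    rewrite ?eq_lshift ?eq_rshift ?eq_lrshift ?eq_rlshift ?linearZl_LR/= ?linearZr_LR/= de ?conjCi;
    by case: (k == l); simpc.
rewrite big_split_ord/= -big_split/=.
have -> : redot u v = \sum_k complex.Re (dot u (e k) * dot (e k) v).
  rewrite /redot {1}(HS u) big_tnth linear_sumlz/=.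
  rewrite (big_morph (@complex.Re R) (id1 := 0) (op1 := +%R)) => [|[? ?] [? ?]//|//].
  by apply: eq_bigr => k _; rewrite linearZl_LR.
apply: eq_bigr => k _; rewrite -[lshift _ _]/(unsplit (inl k)) -[rshift _ _]/(unsplit (inr k)).
rewrite !unsplitK /redot linearZl_LR/= linearZr_LR/= conjCi.
case: (dot u (e k)) => a b; case: (dot (e k) v) => c d.
by simpc => /=; ring.
Qed.

Variables (G : topologicalGroupType) (rho : G -> 'End(V)).
Hypothesis hrho : unitary_representation dot rho.

Lemma redot_unitary g u v : redot (rho g u) (rho g v) = redot u v.
Proof. by rewrite /redot (repr_unitary hrho). Qed.

Lemma redot_adjoint g u v : redot (rho g u) v = redot u (rho g^-1%g v).
Proof.
rewrite -(redot_unitary g u) -comp_lfunE -(repr_mul hrho) mulgV (repr_one hrho).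
by rewrite id_lfunE.
Qed.

(** The matrix of [rho g] in a real orthonormal basis is orthogonal, so the Cauchy-Schwarz bound
    [le_f] keeps its entries in [-1, 1]. *)
Lemma unitary_bounded_rep : exists N (r : G -> 'M[R]_N), bounded_rep r /\
  forall g, r g = 1%:M -> rho g = \1%VF.
Proof.
have [N [f [df Hf]]] := redot_basis.
have le_f u c : redot u (f c) ^+ 2 <= redot u u.
  rewrite (Hf u u) (bigD1 c)//= (redotC (f c) u) -expr2 lerDl sumr_ge0// => a _.
  by rewrite (redotC (f a) u) -expr2 sqr_ge0.
have f0 u : (forall c, redot u (f c) = 0) -> u = 0.
  move=> uf; apply: contraTeq isT => /redot_norm_gt0.
  by rewrite Hf big1 ?ltxx// => c _; rewrite uf mul0r.
exists N, (fun g => \matrix_(c, b) redot (rho g (f b)) (f c)); split; last first.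
  move=> g rg; have gf b : rho g (f b) = f b.
    apply/eqP; rewrite -subr_eq0; apply/eqP/f0 => c.
    rewrite redotDl redotNl df; move/matrixP : rg => /(_ c b).
    by rewrite !mxE => ->; rewrite eq_sym subrr.
  (* The coordinates of [rho g v] are those of [v] tested against [rho g^-1 (f c)], so fixing the
     basis under the inverse settles all [v]. *)
  have gVf b : rho g^-1%g (f b) = f b.
    rewrite -{1}(gf b) -comp_lfunE -(repr_mul hrho) mulVg (repr_one hrho).
    by rewrite id_lfunE.
  apply/lfunP => v; rewrite id_lfunE; apply/eqP; rewrite -subr_eq0; apply/eqP/f0 => c.
  by rewrite redotDl redotNl redot_adjoint gVf subrr.
split=> [|g h|g|c b].
- by apply/matrixP => c b; rewrite !mxE (repr_one hrho) id_lfunE df eq_sym.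
- apply/matrixP => c a; rewrite !mxE (repr_mul hrho) comp_lfunE redot_adjoint Hf.
  by apply: eq_bigr => b _; rewrite !mxE mulrC -redot_adjoint.
- apply: mx_norm_le => // c b; rewrite mxE -sqrtr_sqr -sqrtr1 ler_wsqrtr//.
  by apply: le_trans (le_f _ _) _; rewrite redot_unitary df eqxx.
- move=> g; apply/cvgrPdist_lt => e e0.
  have := repr_continuous hrho g (f b) (exprn_gt0 2 e0).
  apply: filterS => h; rewrite !mxE distrC => hg.
  rewrite -redotNl -redotDl -(@ltr_pXn2r _ 2)// ?nnegrE ?(ltW e0)// real_normK ?num_real//.
  apply: le_lt_trans (le_f _ _) _; rewrite /redot.
  by move: hg; case: (dot _ _) => x y; rewrite ltcE/= => /andP[].
Qed.

End UnitaryToBounded.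

Lemma coset_eq_rep (R : realType) (G : topologicalGroupType) (x y : G) :
  ~~ coset_eq R x y -> exists N (r : G -> 'M[R]_N), bounded_rep r /\ r x <> r y.
Proof.
move=> /negP xy; apply: contrapT => H; apply: xy; apply/asboolP => V dot rho hrho.
have [N [r [hr rP]]] := unitary_bounded_rep hrho; apply: rP.
have rxy : r x = r y by apply: contrapT => rxy; apply: H; exists N, r.
by rewrite (brepM hr) -rxy -(brepM hr) mulVg (brep1 hr).
Qed.

(** * Measures from finitely additive contents *)

Lemma countable_avoid (R : realType) (C : set R) (a b : R) : countable C -> a < b ->
  exists2 t, a < t < b & ~ C t.
Proof.
move=> cC ab; apply: contrapT => H.
have sub : `]a, b[%classic `<=` C.
  by move=> t /=; rewrite in_itv/= => tab; apply: contrapT => nCt; apply: H; exists t.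
have := countable_lebesgue_measure0 (sub_countable (subset_card_le sub) cC).
rewrite lebesgue_measure_itv/= lte_fin ab => /eqP.
by rewrite -EFinB eqe subr_eq0 gt_eqF.
Qed.

(* [nu] is only finitely additive; the total mass survives the passage to
   countable covers when [nu] is carried by a compact set. *)
Section ContentExtension.
Variables (R : realType) (X : ptopologicalType) (nu : set X -> R).
Hypothesis nu0 : nu set0 = 0.
Hypothesis nu_ge0 : forall U, open U -> 0 <= nu U.
Hypothesis nu_add : forall U V W, open U -> open V -> open W ->
  U `&` V = set0 -> U `|` V `<=` W -> nu U + nu V <= nu W.
Hypothesis nu_sub : forall U V, open U -> open V -> nu (U `|` V) <= nu U + nu V.

Lemma nu_le U V : open U -> open V -> U `<=` V -> nu U <= nu V.
Proof.
move=> oU oV UV; have := nu_add oU open0 oV (setI0 _).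
by rewrite setU0 nu0 addr0; exact.
Qed.

Lemma nu_bigU (V : nat -> set X) n : (forall k, open (V k)) ->
  nu (\big[setU/set0]_(k < n) V k) <= \sum_(k < n) nu (V k).
Proof.
move=> oV; elim: n => [|n IH]; first by rewrite !big_ord0 nu0.
rewrite !big_ord_recr/=; apply: le_trans (nu_sub _ (oV n)) _; last by rewrite lerD2r.
by rewrite -(bigcup_mkord n V); apply: bigcup_open.
Qed.

Local Notation bX := (g_sigma_algebraType (@open X)).

(** The infinite cost of non-open sets leaves only open covers to compete in [mu_ext]. *)
Definition open_cost (V : set bX) : \bar R :=
  if `[< open (V : set X) >] then (nu V)%:E else +oo%E.

Lemma open_cost_open (V : set X) : open V -> open_cost V = (nu V)%:E.
Proof. by move=> oV; rewrite /open_cost asboolT. Qed.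

Lemma open_cost0 : open_cost set0 = 0%E.
Proof. by rewrite open_cost_open ?nu0//; exact: open0. Qed.

Lemma open_cost_ge0 V : (0 <= open_cost V)%E.
Proof. by rewrite /open_cost; case: asboolP => // oV; rewrite lee_fin nu_ge0. Qed.

Definition content_ext (A : set X) : \bar R := mu_ext open_cost A.

Lemma content_ext0 : content_ext set0 = 0%E.
Proof. by apply: mu_ext0; [exact: open_cost0|exact: open_cost_ge0]. Qed.

Lemma content_ext_ge0 A : (0 <= content_ext A)%E.
Proof. by apply: mu_ext_ge0; exact: open_cost_ge0. Qed.

Lemma le_content_ext A B : A `<=` B -> (content_ext A <= content_ext B)%E.
Proof. by move=> AB; exact: (@le_mu_ext _ bX R open_cost A B AB). Qed.

Lemma content_ext_sigma_subadditive : sigma_subadditive content_ext.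
Proof. by move=> F; exact: (@mu_ext_sigma_subadditive _ bX R open_cost open_cost_ge0 F). Qed.

HB.instance Definition _ := isOuterMeasure.Build R X content_ext
  content_ext0 content_ext_ge0 le_content_ext content_ext_sigma_subadditive.

Definition content_outer : {outer_measure set X -> \bar R} := content_ext.

Lemma content_ext_cover (V : nat -> set X) A : (forall k, open (V k)) ->
  A `<=` \bigcup_k V k -> (content_ext A <= \sum_(k <oo) (nu (V k))%:E)%E.
Proof.
move=> oV AV; apply: ereal_inf_lbound; exists V; last first.
  by apply: eq_eseriesr => k _; rewrite open_cost_open.
by split=> // k; exact: sub_sigma_algebra.
Qed.

Lemma content_ext_open U : open U -> (content_ext U <= (nu U)%:E)%E.
Proof.
move=> oU; pose V k := if k is 0%N then U else set0.
have oV k : open (V k) by case: k => //= _; exact: open0.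
apply: le_trans (@content_ext_cover V _ oV _) _; first by move=> x Ux; exists 0%N.
rewrite nneseries_recl//; last by move=> k _; rewrite lee_fin nu_ge0.
by rewrite eseries_cond/= eseries0 ?adde0// => -[|k]//= _ _; rewrite nu0.
Qed.

Lemma content_ext_le1 A : nu setT = 1 -> (content_ext A <= 1)%E.
Proof.
move=> nuT; apply: le_trans (le_outer_measure _ _ _ (@subsetT _ A)) _.
by rewrite -[1%E]/(1%R%:E) -nuT; apply: content_ext_open; exact: openT.
Qed.

Lemma content_ext_adherent A e : nu setT = 1 -> 0 < e ->
  exists V : nat -> set X, [/\ forall k, open (V k), A `<=` \bigcup_k V k &
    (\sum_(k <oo) (nu (V k))%:E <= content_ext A + e%:E)%E].
Proof.
move=> nuT e0.
have fA : content_ext A \is a fin_num.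
  rewrite ge0_fin_numE ?outer_measure_ge0//.
  exact: le_lt_trans (content_ext_le1 A nuT) (ltry 1).
have [_ [V [_ AV] <-] VA] := lb_ereal_inf_adherent e0 fA.
(* A single non-open member would make the cost of this cover infinite. *)
have oV k : open (V k : set X).
  apply: contrapT => noV; have Voo : open_cost (V k) = +oo%E by rewrite /open_cost asboolF.
  move: VA; rewrite (eseries_pinfty _ _ Voo)// => [|n _]; first by rewrite ltNge leey.
  by rewrite -ltNye (lt_le_trans _ (open_cost_ge0 _)).
exists V; split=> //; apply: le_trans (ltW VA).
by apply: lee_nneseries => k _; rewrite ?lee_fin ?nu_ge0// open_cost_open.
Qed.

(** Compactness reduces a countable open cover to a finite one, for which finite subadditivity of
    [nu] is enough. *)
Lemma content_ext_compact K : nu setT = 1 -> compact K ->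
  (forall V, open V -> K `<=` V -> 1 <= nu V) -> (1 <= content_ext K)%E.
Proof.
move=> nuT cK HK; apply/lee_addgt0Pr => e e0.
have [V [oV KV]] := content_ext_adherent K nuT e0; apply: le_trans.
have [n Kn] : exists n, K `<=` \big[setU/set0]_(k < n) V k.
  apply: (compact_induction (P := fun A => exists n, A `<=` \big[setU/set0]_(k < n) V k)) cK _ _ _ _.
  - by exists 0%N.
  - by move=> A B AB [n Bn]; exists n; exact: subset_trans Bn.
  - move=> A B [n An] [p Bp]; exists (maxn n p) => x [/An|/Bp].
      by apply: subset_bigsetU; rewrite leq_maxl.
    by apply: subset_bigsetU; rewrite leq_maxr.
  - move=> x /KV[k _ Vkx]; exists (V k); first exact: open_nbhs_nbhs.
    by exists k.+1 => y [_ Vy]; rewrite big_ord_recr; right.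
have oVn : open (\big[setU/set0]_(k < n) V k).
  by rewrite -(bigcup_mkord n V); apply: bigcup_open.
apply: (@le_trans _ _ (\sum_(k < n) (nu (V k))%:E)%E).
  by rewrite sumEFin lee_fin; apply: le_trans (nu_bigU n oV); exact: HK.
rewrite -(big_mkord xpredT (fun k => (nu (V k))%:E)).
by apply: nneseries_lim_ge => k _ _; rewrite lee_fin nu_ge0.
Qed.

Lemma content_ext_preimage (T : X -> X) A : nu setT = 1 -> continuous T ->
  (forall V, open V -> nu (T @^-1` V) = nu V) -> (content_ext (T @^-1` A) <= content_ext A)%E.
Proof.
move=> nuT cT nuTV; apply/lee_addgt0Pr => e e0.
have [V [oV AV]] := content_ext_adherent A nuT e0; apply: le_trans.
apply: le_trans (@content_ext_cover (fun k => T @^-1` V k) _ _ _) _.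
- by move=> k; apply: open_comp.
- by move=> x /AV[k _ Vk]; exists k.
- by apply: lee_nneseries => k _; rewrite ?nuTV ?lee_fin ?nu_ge0.
Qed.

Section Sublevels.
Variable f : X -> R.
Hypothesis cf : continuous f.
Hypothesis nuT : nu setT = 1.

Lemma open_lt_fun t : open [set x | f x < t].
Proof. by apply: (@open_comp _ _ f [set y | y < t]) => [x _|]; [exact: cf|exact: open_lt]. Qed.

Lemma open_gt_fun t : open [set x | t < f x].
Proof. by apply: (@open_comp _ _ f [set y | t < y]) => [x _|]; [exact: cf|exact: open_gt]. Qed.

(** These are the levels where the distribution function of [f] under [nu] does not jump. *)
Definition null_level t := forall e, 0 < e ->
  exists2 d, 0 < d & nu [set x | t - d < f x < t + d] <= e.

Lemma open_shell t d : open [set x | t - d < f x < t + d].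
Proof.
have -> : [set x | t - d < f x < t + d] = [set x | t - d < f x] `&` [set x | f x < t + d].
  by rewrite eqEsubset; split=> x /=; [move/andP|move=> [-> ->]].
by apply: openI; [exact: open_gt_fun|exact: open_lt_fun].
Qed.

(* Only finitely additive information is available, so [{f = t}] has to be
   covered by a shell around it. *)
Lemma caratheodory_null_level t : null_level t ->
  content_ext.-caratheodory [set x | f x < t].
Proof.
move=> nt; apply: le_caratheodory_measurable => A.
apply/lee_addgt0Pr => e e0; have e2 : 0 < e / 2 by rewrite divr_gt0.
have [V [oV AV VA]] := content_ext_adherent A nuT e2.
have [d d0 Sd] := nt _ e2; set S := [set x | _] in Sd.
set L := [set x | f x < t]; pose U := [set x | t < f x].
have oL : open L by exact: open_lt_fun.
have oU : open U by exact: open_gt_fun.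
have h1 : (content_ext (A `&` L) <=
    \sum_(k <oo) (nu (V k `&` L))%:E)%E.
  apply: content_ext_cover => [k|x [/AV[k _ Vk] fx]]; last by exists k.
  by apply: openI => //; exact: oL.
have h2 : (content_ext (A `&` ~` L) <=
    (e / 2)%:E + \sum_(k <oo) (nu (V k `&` U))%:E)%E.
  apply: (@le_trans _ _ (content_ext (S `|` \bigcup_k (V k `&` U)))).
    apply: le_outer_measure => x [/AV[k _ Vk]] /= /negP; rewrite -leNgt le_eqVlt.
    move=> /predU1P[tx|tx]; last by right; exists k.
    by left; rewrite /S/= -tx; apply/andP; split; lra.
  apply: le_trans (outer_measureU2 _ _ _) _; apply: leeD.
    by apply: le_trans (content_ext_open (open_shell _ _)) _; rewrite lee_fin.
  by apply: content_ext_cover => // k; apply: openI => //; exact: oU.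
apply: le_trans (leeD h1 h2) _; rewrite addeCA -nneseriesD; last 2 first.
- by move=> k _ _; rewrite lee_fin nu_ge0//; apply: openI => //; exact: oL.
- by move=> k _ _; rewrite lee_fin nu_ge0//; apply: openI => //; exact: oU.
rewrite [e in leRHS]splitr EFinD addeA addeC; apply: leeD => //.
apply: le_trans VA; apply: lee_nneseries => k _.
  by rewrite -EFinD lee_fin addr_ge0// nu_ge0//; exact: openI.
rewrite -EFinD lee_fin; apply: nu_add => //.
- by apply: openI => //; exact: oL.
- by apply: openI => //; exact: oU.
- by rewrite -subset0 => x [[_ /= xt] [_ /= tx]]; have := lt_trans xt tx; rewrite ltxx.
- by move=> x [[]|[]].
Qed.

Lemma countable_nonnull_level : countable [set t | ~ null_level t].
Proof.
pose phi t := nu [set x | f x < t].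
have phi_le s t : s <= t -> phi s <= phi t.
  by move=> st; apply: nu_le; try exact: open_lt_fun; move=> x /= /lt_le_trans; apply.
have phi0 t : 0 <= phi t by apply: nu_ge0; exact: open_lt_fun.
have phi1 t : phi t <= 1 by rewrite -nuT; apply: nu_le => //; [exact: open_lt_fun|exact: openT].
pose L t := [set phi s | s in [set s | s < t]].
pose U t := [set phi s | s in [set s | t < s]].
have hL t : has_sup (L t).
  split; first by exists (phi (t - 1)), (t - 1) => //=; lra.
  by exists 1 => _ [s _ <-].
have hU t : has_inf (U t).
  split; first by exists (phi (t + 1)), (t + 1) => //=; lra.
  by exists 0 => _ [s _ <-].
apply: (@sub_countable _ _ _ [set t | sup (L t) < inf (U t)]); last first.
  apply: countable_jumps => s t st; apply: (@le_trans _ _ (phi ((s + t) / 2))).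
    by apply: ge_inf; [case: (hU s)|exists ((s + t) / 2) => //=; lra].
  by apply: ub_le_sup; [case: (hL t)|exists ((s + t) / 2) => //=; lra].
apply: subset_card_le => t /=; apply: contra_notP => /negP; rewrite -leNgt => UL e e0.
have e2 : 0 < e / 2 by rewrite divr_gt0.
have [_ [s1 /= s1t <-] s1L] := sup_adherent e2 (hL t).
have [_ [s2 /= s2t <-] s2U] := inf_adherent e2 (hU t).
(* With this width the shell is disjoint from [{f < s1}] and both lie in [{f < s2}], so its content
   is at most [phi s2 - phi s1]. *)
exists (Num.min (t - s1) (s2 - t)); first by rewrite lt_min !subr_gt0 s1t.
set d := Num.min _ _.
have dl : d <= t - s1 by rewrite ge_min lexx.
have dr : d <= s2 - t by rewrite ge_min lexx orbT.
have := @nu_add [set x | f x < s1] [set x | t - d < f x < t + d] [set x | f x < s2]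
  (open_lt_fun _) (open_shell _ _) (open_lt_fun _).
rewrite -/(phi s1) -/(phi s2) => /(_ _ _)/le_trans => H.
have : phi s1 + nu [set x | t - d < f x < t + d] <= phi s2.
  apply: H => //; first by rewrite -subset0 => x [/= h1 /andP[h2 _]]; lra.
  by move=> x [/= h|/= /andP[_ h]]; lra.
by move: s1L s2U UL; rewrite -/(phi s1) -/(phi s2); lra.
Qed.

(** All but countably many levels are null, so null levels approach [t] from below, and the sublevel
    set is a countable union of theirs. *)
Lemma caratheodory_lt_fun t : content_ext.-caratheodory [set x | f x < t].
Proof.
have H n : exists s, t - n.+1%:R^-1 < s < t /\ null_level s.
  have [|s st /contrapT ns] := countable_avoid countable_nonnull_level (_ : t - n.+1%:R^-1 < t).
    by rewrite ltrBlDr ltrDl invr_gt0.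
  by exists s.
have [s sP] := choice H.
have -> : [set x | f x < t] = \bigcup_n [set x | f x < s n].
  rewrite eqEsubset; split=> [x /= fx|x [n _ /= fx]]; last first.
    by have [/andP[_ ]] := sP n; move=> + _; exact: lt_trans.
  have d0 : 0 < t - f x by rewrite subr_gt0.
  pose n := Num.truncn (t - f x)^-1; exists n => //=.
  have [/andP[sn _] _] := sP n.
  apply: le_lt_trans sn; rewrite lerBrDr -lerBrDl.
  rewrite -[leRHS]invrK lef_pV2 ?posrE ?invr_gt0//.
  exact/ltW/real_truncnS_gt/num_real.
apply: caratheodory_measurable_bigcup => n; apply: caratheodory_null_level.
by have [] := sP n.
Qed.

End Sublevels.
End ContentExtension.

Lemma outer_measure_probability (R : realType) (X : pointedType) (F : set (set X))
    (mu : {outer_measure set X -> \bar R}) :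
  (forall A, F A -> mu.-caratheodory A) -> mu setT = 1%E ->
  exists P : probability (g_sigma_algebraType F) R, forall A, P A = mu A.
Proof.
move=> Fmu muT; pose X' := g_sigma_algebraType F.
have mc (A : set X') : measurable A -> mu.-caratheodory A.
  move: A; apply: smallest_sub => //; split.
  - exact: caratheodory_measurable_set0.
  - by move=> A cA; rewrite setTD; exact: caratheodory_measurable_setC.
  - by move=> A cA; exact: caratheodory_measurable_bigcup.
have sa : semi_sigma_additive (mu : set X' -> \bar R).
  move=> A mA tA mUA.
  apply: (@caratheodory_measure_sigma_additive R X mu A _ tA _) => [n|]; exact: mc.
pose m0 := isMeasure.Build _ X' R mu (outer_measure0 mu) (outer_measure_ge0 mu) sa.
pose P0 : {measure set X' -> \bar R} := HB.pack (mu : set X' -> \bar R) m0.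
pose P : probability X' R := HB.pack (mu : set X' -> \bar R) m0
  (Measure_isProbability.Build _ X' R P0 muT).
by exists P.
Qed.

Lemma countableU T (A B : set T) : countable A -> countable B -> countable (A `|` B).
Proof.
move=> cA cB; rewrite -[A `|` B](_ : \bigcup_(b in [set: bool]) (if b then A else B) = _).
  by apply: bigcup_countable => // -[].
rewrite eqEsubset; split=> [x [[] _ ?]|x [?|?]]; [by left|by right|by exists true|].
by exists false.
Qed.

(** * Separability of countably generated probability spaces *)

Section Separable.
Variables (R : realType) (X : pointedType) (F : set (set X)).
Hypothesis cF : countable F.

Fixpoint boolean_closure n : set (set X) :=
  if n is k.+1 then
    [set ~` A | A in boolean_closure k] `|`
    [set p.1 `|` p.2 | p in boolean_closure k `*` boolean_closure k]
  else set0 |` F.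

Lemma countable_boolean_closure n : countable (boolean_closure n).
Proof.
elim: n => [|n IH] /=; first by apply: countableU => //; exact: finite_set_countable.
apply: countableU; apply: (sub_countable (card_image_le _ _)) => //.
exact: countableX.
Qed.

Lemma boolean_closureS n : boolean_closure n `<=` boolean_closure n.+1.
Proof. by move=> A nA; right; exists (A, A) => //=; rewrite setUid. Qed.

Lemma boolean_closure_le n p : (n <= p)%N -> boolean_closure n `<=` boolean_closure p.
Proof.
move=> np; rewrite -(subnK np); elim: (p - n)%N => [//|k IH].
by rewrite addSn; apply: subset_trans IH _; exact: boolean_closureS.
Qed.

(** The Boolean algebra [S] generated by [F] is countable, and the sets that it approximates in
    measure form a sigma-algebra [D] containing [F]. *)
Lemma separable_countably_generated (mu : probability (g_sigma_algebraType F) R) :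
  separable_probability mu.
Proof.
pose X' := g_sigma_algebraType F.
pose S := \bigcup_n boolean_closure n.
have S0 : S set0 by exists 0%N => //; left.
have SF A : F A -> S A by move=> FA; exists 0%N => //; right.
have SC A : S A -> S (~` A) by move=> [n _ nA]; exists n.+1 => //; left; exists A.
have SU A B : S A -> S B -> S (A `|` B).
  move=> [n _ nA] [p _ pB]; exists (maxn n p).+1 => //; right; exists (A, B) => //=.
  by split; [apply: boolean_closure_le nA; rewrite leq_maxl|apply: boolean_closure_le pB; rewrite leq_maxr].
have mS (A : set X') : S A -> measurable A.
  move=> [n _]; elim: n A => [|n IH] A /= [].
  - by move=> ->; exact: measurable0.
  - exact: sub_sigma_algebra.
  - by move=> [B nB <-]; apply: measurableC; exact: IH.
  - by move=> [[B C] /= [nB nC] <-]; apply: measurableU; exact: IH.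
pose sd (A B : set X') : set X' := (A `\` B) `|` (B `\` A).
have msd (A B : set X') : measurable A -> measurable B -> measurable (sd A B).
  by move=> mA mB; apply: measurableU; exact: measurableD.
pose D := [set A : set X' | measurable A /\
  forall e : R, 0 < e -> exists2 C, S C & (mu (sd A C) < e%:E)%E].
have DS A : S A -> D A.
  move=> SA; split; first exact: mS.
  by move=> e e0; exists A => //; rewrite /sd setDv setU0 measure0 lte_fin.
have le_mu (A B : set X') : measurable A -> measurable B -> A `<=` B -> (mu A <= mu B)%E.
  by move=> mA mB AB; apply: le_measure; rewrite ?inE.
have DU A B : D A -> D B -> D (A `|` B).
  move=> [mA hA] [mB hB]; split=> [|e e0]; first exact: measurableU.
  have e2 : 0 < e / 2 by rewrite divr_gt0.
  have [C SCC AC] := hA _ e2; have [C' SC' BC'] := hB _ e2.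
  exists (C `|` C'); first exact: SU.
  have mC := mS _ SCC; have mC' := mS _ SC'.
  apply: (@le_lt_trans _ _ (mu (sd A C `|` sd B C'))).
    apply: le_mu; [apply: msd; exact: measurableU|apply: measurableU; exact: msd|].
    move=> x [[[Ax|Bx] nx]|[[Cx|Cx] nx]].
    - by left; left; split=> // Cx; apply: nx; left.
    - by right; left; split=> // Cx; apply: nx; right.
    - by left; right; split=> // Cx'; apply: nx; left.
    - by right; right; split=> // Cx'; apply: nx; right.
  apply: le_lt_trans (measureU2 _ (msd _ _ mA mC) (msd _ _ mB mC')) _.
  by rewrite [e]splitr EFinD; apply: lteD.
have DsF : measurable `<=` D.
  apply: smallest_sub; last by move=> A FA; apply: DS; exact: SF.
  split=> [|A [mA hA]|A DA]; first exact: DS.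
    split=> [|e e0]; first exact: measurableD.
    have [C SCC AC] := hA e e0; exists (~` C); first exact: SC.
    rewrite (_ : sd _ _ = sd A C)// setTD /sd !setDE !setCK setUC.
    by congr (_ `|` _); exact: setIC.
  have mA n : measurable (A n : set X') by case: (DA n).
  split=> [|e e0]; first exact: bigcup_measurable.
  have e2 : 0 < e / 2 by rewrite divr_gt0.
  pose B n : set X' := \big[setU/set0]_(k < n) A k.
  have DB n : D (B n).
    by rewrite /B; elim/big_ind : _ => //; exact: DS.
  have mB n : measurable (B n) by case: (DB n).
  have BB n p x : (n <= p)%N -> B n x -> B p x.
    by rewrite /B -!bigcup_mkord => np [k kn Ak]; exists k => //=; exact: leq_trans np.
  (* These remainders decrease to the empty set, so some finite union [B n] is within [e / 2] of the
     whole union and can itself be approximated from [S]. *)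
  pose E n : set X' := \bigcup_k A k `\` B n.
  have mE n : measurable (E n) by apply: measurableD => //; exact: bigcup_measurable.
  have cE : mu \o E @ \oo --> mu (\bigcap_n E n).
    apply: nonincreasing_cvg_mu => //.
    - by apply: le_lt_trans (probability_le1 mu (mE 0%N)) _; rewrite ltry.
    - exact: bigcap_measurableType.
    - by move=> n p np; apply/subsetPset => x [Ax nBx]; split=> // Bx; apply: nBx; exact: BB Bx.
  have E0 : \bigcap_n E n = set0.
    rewrite -subset0 => x Ex; have [[k _ Akx] _] := Ex 0%N I.
    by have [_] := Ex k.+1 I; apply; rewrite /B big_ord_recr; right.
  rewrite E0 measure0 in cE.
  have [n _ /(_ n (leqnn _)) /= En] : \forall n \near \oo, (mu (E n) < (e / 2)%:E)%E.
    have e0nbhs : nbhs (0%E : \bar R) [set x | (x < (e / 2)%:E)%E].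
      by apply: open_nbhs_nbhs; split; [exact: open_ereal_lt_ereal|rewrite /= lte_fin].
    exact: cE _ e0nbhs.
  have [_ /(_ _ e2)[C SCC BC]] := DB n.
  exists C => //; have mC := mS _ SCC.
  apply: (@le_lt_trans _ _ (mu (E n `|` sd (B n) C))).
    apply: le_mu; first by apply: msd => //; exact: bigcup_measurable.
      by apply: measurableU => //; exact: msd.
    move=> x [[Ax nC]|[Cx nA]].
      have [Bx|nBx] := pselect (B n x); first by right; left.
      by left.
    right; right; split=> // Bx; apply: nA; move: Bx; rewrite /B.
    by rewrite -bigcup_mkord => -[k _ Ak]; exists k.
  apply: le_lt_trans (measureU2 _ (mE n) (msd _ _ (mB n) mC)) _.
  by rewrite [e]splitr EFinD; apply: lteD.
have cS : countable S by apply: bigcup_countable => // n _; exact: countable_boolean_closure.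
have [S00|[C]] := pfcard_geP cS; first by move: S0; rewrite S00.
exists C; split=> [n|A e mA e0]; first by apply: mS; exact: funS.
have [_ /(_ e e0)[B SB AB]] := DsF A mA.
have [n _ CnB] := @surj _ _ _ _ C B SB.
by exists n; rewrite CnB.
Qed.

End Separable.

(** * Return times of matrix actions *)

(** Every set of measurable recurrence meets such a [U] outside each compact set. *)
Definition return_time_set (R : realType) (G : topologicalGroupType) (U : set G) :=
  exists (d : measure_display) (X : measurableType d) (mu : probability X R)
    (T : G -> X -> X) (A : set X),
    [/\ separable_probability mu, measure_preserving_action mu T, measurable A,
        (0 < mu A)%E & forall g, (0 < mu (A `&` T g @` A))%E -> U g].

Lemma compact_mx_cube (R : realType) (N : nat) :
  compact [set x : 'M[R]_N | forall i j, `|x i j| <= 1].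
Proof.
have cv : continuous (@vec_mx R N N).
  apply: mx_continuous => i j.
  have -> : (fun v => (vec_mx v : 'M[R]_N) i j) = (fun v : 'rV_(N * N) => v 0 (mxvec_index i j)).
    by apply/funext => v; rewrite -(mxvecE (vec_mx v) i j) vec_mxK.
  exact: coord_continuous.
have -> : [set x : 'M[R]_N | forall i j, `|x i j| <= 1] =
    vec_mx @` [set v : 'rV[R]_(N * N) | forall k, (`[-1, 1]%classic : set R) (v ord0 k)].
  rewrite eqEsubset; split=> [x Hx|_ [v Hv <-] i j].
    exists (mxvec x); last exact: mxvecK.
    by move=> k; case/mxvec_indexP: k => i j; rewrite mxvecE /= in_itv/= -ler_norml.
  by have := Hv (mxvec_index i j); rewrite /= in_itv/= -ler_norml -{1}(vec_mxK v) mxvecE.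
apply: continuous_compact; first exact: continuous_subspaceT.
by apply: (@rV_compact R _ (fun=> `[-1, 1]%classic)) => k; exact: segment_compact.
Qed.

Section RepReturnTimes.
Variables (R : realType) (G : topologicalGroupType).
Variable m : {measure set (borel G) -> \bar R}.
Variable M : (borel G -> R) -> R.
Hypothesis ML : forall (a : R) f1 f2, f1 \in Lfun m +oo%E -> f2 \in Lfun m +oo%E ->
  M (fun x => a * f1 x + f2 x) = a * M f1 + M f2.
Hypothesis Mpos : forall f, f \in Lfun m +oo%E ->
  {ae m, forall x, 0 <= f x} -> 0 <= M f.
Hypothesis M1 : M (cst 1) = 1.
Hypothesis Minv : forall g f, f \in Lfun m +oo%E -> M (fun x => f (g^-1 * x)%g) = M f.

Variables (N : nat) (r : G -> 'M[R]_N).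
Hypothesis hr : bounded_rep r.

(** This is the image of the invariant mean under [r]: a finitely additive content on matrices,
    preserved by left multiplication by each [r g]. *)
Let nu (V : set 'M[R]_N) : R := mean_set M (r @^-1` V).

Let mr V : open V -> measurable (r @^-1` V : set (borel G)).
Proof.
by move=> oV; apply: open_borel; apply: open_comp => // x _; exact: brep_continuous.
Qed.

Let nu0 : nu set0 = 0.
Proof.
rewrite /nu preimage_set0; have /eqP := mean_setU ML measurable0 measurable0 (setI0 _).
by rewrite setU0 -subr_eq subrr => /eqP.
Qed.

Let nu_ge0 V : open V -> 0 <= nu V.
Proof. by move=> oV; apply: mean_set_ge0 Mpos _ _; exact: mr. Qed.

Let nuT : nu setT = 1.
Proof. by rewrite /nu preimage_setT mean_setT. Qed.

Let mean_set_le (A B : set (borel G)) : measurable A -> measurable B -> A `<=` B ->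
  mean_set M A <= mean_set M B.
Proof.
move=> mA mB AB; have mBA : measurable (B `\` A) by exact: measurableD.
rewrite -(setDUK AB) (mean_setU ML)//; last by rewrite setDE setICA setICr setI0.
by rewrite lerDl; exact: mean_set_ge0 Mpos _ _.
Qed.

Let nu_add U V W : open U -> open V -> open W ->
  U `&` V = set0 -> U `|` V `<=` W -> nu U + nu V <= nu W.
Proof.
move=> oU oV oW UV0 UVW; rewrite /nu -(mean_setU ML); try exact: mr.
  apply: mean_set_le; [apply: measurableU; exact: mr|exact: mr|].
  by move=> x UVx; apply: UVW; case: UVx; [left|right].
by rewrite -preimage_setI UV0 preimage_set0.
Qed.

Let nu_sub U V : open U -> open V -> nu (U `|` V) <= nu U + nu V.
Proof.
move=> oU oV; have mU := mr oU; have mV := mr oV.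
have mVU : measurable ((r @^-1` V `\` r @^-1` U) : set (borel G)) by exact: measurableD.
have -> : nu (U `|` V) = mean_set M (r @^-1` U `|` (r @^-1` V `\` r @^-1` U)).
  congr mean_set; rewrite eqEsubset; split=> x /= [Ux|Vx]; try by left.
    by have [Ux|nUx] := pselect (U (r x)); [left|right].
  by case: Vx; right.
rewrite (mean_setU ML)//; last by rewrite setDE setICA setICr setI0.
by rewrite lerD2l; apply: mean_set_le => // x [].
Qed.

Let T (g : G) (x : 'M[R]_N) : 'M[R]_N := r g *m x.

Let cT g : continuous (T g).
Proof.
move=> x; apply/(@cvgrPdist_lt _ _ _ _ (nbhs_filter x)) => e e0.
have d0 : 0 < e / N.+1%:R by rewrite divr_gt0.
have : \forall y \near x, `|x - y| < e / N.+1%:R by exact: (@cvgr_dist_lt _ _ _ _ (nbhs_filter x) _ _ cvg_id _ d0).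
apply: filterS => y xy; rewrite /T -mulmxBr; apply: le_lt_trans (mx_norm_mul _ _) _.
apply: (@le_lt_trans _ _ (N.+1%:R * `|x - y|)).
  by rewrite -mulrA ler_pM ?ler_nat// ler_piMl// (brep_le1 hr).
by rewrite mulrC -ltr_pdivlMr.
Qed.

Let T1 x : T 1%g x = x.
Proof. by rewrite /T (brep1 hr) mul1mx. Qed.

Let TM g h x : T (g * h)%g x = T g (T h x).
Proof. by rewrite /T (brepM hr) mulmxA. Qed.

Let nu_preimage g V : open V -> nu (T g @^-1` V) = nu V.
Proof.
move=> oV; rewrite /nu -(mean_set_translate Minv g^-1%g (mr oV)) left_translateE.
by congr mean_set; apply/funext => h; rewrite /= /T invgK (brepM hr).
Qed.

Let mu0 : {outer_measure set 'M[R]_N -> \bar R} := content_outer nu0 nu_ge0.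

Let mu0T : mu0 setT = 1%E.
Proof.
apply/eqP; rewrite eq_le content_ext_le1//=.
apply: le_trans (le_outer_measure mu0 _ _ (@subsetT _ _)).
(* An open set containing the cube contains the range of [r], hence has full content. *)
apply: (content_ext_compact nu0 nu_ge0 nu_sub nuT (@compact_mx_cube R N)) => V oV KV.
suff -> : nu V = nu setT by rewrite nuT.
rewrite /nu; congr mean_set; rewrite eqEsubset; split=> // g _; apply: KV => i j.
exact: le_trans (ler_mx_coord _ _ _) (brep_le1 hr g).
Qed.

Let mu0_preimage g A : mu0 (T g @^-1` A) = mu0 A.
Proof.
have le h B : (mu0 (T h @^-1` B) <= mu0 B)%E.
  by apply: content_ext_preimage => // V; exact: nu_preimage.
apply/eqP; rewrite eq_le le/=.
have {1}-> : A = T g^-1%g @^-1` (T g @^-1` A).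
  by apply/funext => x /=; rewrite -TM mulgV T1.
exact: le.
Qed.

(** Rational bounds keep the generators countable, which gives separability, and as sublevel sets of
    coordinates they are Carathéodory measurable. *)
Definition halfspaces : set (set 'M[R]_N) :=
  range (fun p : 'I_N * 'I_N * rat => [set x : 'M[R]_N | x p.1.1 p.1.2 < ratr p.2]).

Lemma countable_halfspaces : countable halfspaces.
Proof. exact/(sub_countable (card_image_le _ _))/countableP. Qed.

Local Notation mX := (g_sigma_algebraType halfspaces).

Lemma measurable_coord i j : measurable_fun setT (fun x : mX => x i j : R).
Proof.
apply: (measurability _ (RGenInftyO.measurableE R)) => _ [_ [t ->] <-]; rewrite setTI.
have -> : (fun x : mX => x i j) @^-1` `]-oo, t[%classic =
    \bigcup_(q in [set q : rat | ratr q <= t]) [set x : mX | x i j < ratr q].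
  rewrite eqEsubset; split=> [x /=|x [q /= qt xq]]; rewrite ?in_itv/=.
    by move=> /rat_in_itvoo[q]; rewrite in_itv/= => /andP[xq qt]; exists q => //=; exact: ltW.
  exact: lt_le_trans qt.
rewrite bigcup_mkcond; apply: bigcupT_measurable_rat => q; case: ifPn => // _.
by apply: sub_sigma_algebra; exists (i, j, q).
Qed.

Lemma rep_return_time_set (e : R) : 0 < e ->
  return_time_set R [set g | `|r g - 1%:M| < e].
Proof.
move=> e0.
have [mu muE] : exists P : probability mX R, forall A, P A = mu0 A.
  apply: outer_measure_probability mu0T => _ [[[i j] q] _ <-].
  exact: (caratheodory_lt_fun nu0 nu_ge0 nu_add (@coord_continuous R N N i j) nuT (ratr q)).
(* If [x] and [y] are within [del] of 1 and [x = r g y], then [r g - 1 = r g (1 - y) + (x - 1)] has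
   norm at most [(N + 1) del = e / 2]. *)
pose del : R := e / 2 / N.+1%:R.
have del0 : 0 < del by rewrite !divr_gt0.
pose A := [set x : 'M[R]_N | `|x - 1%:M| <= del].
have cA : closed A.
  apply: (@closed_comp _ _ (fun x : 'M[R]_N => `|x - 1%:M|) [set y | y <= del]).
    move=> x _; apply: (@cvg_norm _ _ _ _ (nbhs_filter x)).
    by apply: cvgB; [exact: cvg_id|exact: cvg_cst].
  exact: closed_le.
have mA : measurable (A : set mX).
  have -> : A = \bigcap_(p in [set: 'I_N * 'I_N])
      (fun x : mX => x p.1 p.2 : R) @^-1` `[(1%:M : 'M[R]_N) p.1 p.2 - del,
        (1%:M : 'M[R]_N) p.1 p.2 + del].
    rewrite eqEsubset; split=> [x Ax p _ /=|x Hx].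
      rewrite in_itv/= -ler_distl; apply: le_trans Ax.
      by apply: le_trans (ler_mx_coord _ p.1 p.2); rewrite !mxE.
    apply: mx_norm_le => [|i j]; first exact: ltW.
    by have := Hx (i, j) I; rewrite /= in_itv/= -ler_distl !mxE.
  apply: fin_bigcap_measurable => [|p _]; first exact: finite_finset.
  by rewrite -[_ @^-1` _]setTI; apply: measurable_coord => //; exact: measurable_itv.
exists _, mX, mu, T, A; split=> //.
- exact: separable_countably_generated countable_halfspaces mu.
- split=> //.
  + apply: (@measurability _ _ _ mX setT _ halfspaces erefl) => _ [_ [[[i j] q] _ <-] <-].
    pose f (gx : borel G * mX) : R := \sum_k r gx.1 i k * gx.2 k j.
    have mf : measurable_fun setT f.
      apply: measurable_sum => k; apply: measurable_funM.
        have mrk : measurable_fun setT (fun g : borel G => r g i k).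
          apply: (measurability _ (RGenOpens.measurableE R)) => _ [_ [a [b ->]] <-].
          rewrite setTI; apply: open_borel; apply: open_comp; last exact: interval_open.
          by move=> x _; exact: brep_coord_continuous.
        exact: (measurableT_comp mrk measurable_fst).
      exact: (measurableT_comp (measurable_coord k j) measurable_snd).
    have -> : (fun gx : borel G * mX => T gx.1 gx.2) @^-1` [set x | x i j < ratr q] =
        f @^-1` `]-oo, ratr q[%classic.
      by apply/funext => gx; rewrite /= in_itv/= /f /T mxE.
    by apply: mf => //; exact: measurable_itv.
  + by move=> g B mB; rewrite !muE mu0_preimage.
- rewrite lt0e measure_ge0 andbT; apply/negP => /eqP muA.
  have d2 : 0 < del / N.+1%:R by rewrite divr_gt0.
  have [I [c [_ Hc]]] := brep_colouring hr d2.
  have [z zP] : exists z : I -> G, forall x, c (z (c x)) = c x.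
    exists (fun i => xget 1%g (c @^-1` [set i])) => x.
    exact: (@xgetPex _ 1%g (c @^-1` [set c x]) (ex_intro _ x erefl)).
  (* If [A] were null, so would be this finite union of its translates. As [W] is closed and
     contains the range of [r], its complement is null too, against total mass 1. *)
  pose W := \bigcup_(i in [set: I]) (T (z i)^-1%g @^-1` A).
  have cW : closed W.
    apply: closed_bigcup => [|i _]; first exact: finite_finset.
    by apply: closed_comp => // x _; exact: cT.
  have rW g : W (r g).
    exists (c g) => //; rewrite /A /= /T -(brepM hr) -(brep1 hr) -(mulVg (z (c g))).
    apply: le_trans (brep_distl hr _ _ _) _.
    apply: (@le_trans _ _ (N.+1%:R * `|r g - r (z (c g))|)).
      by rewrite ler_wpM2r// ler_nat.
    by rewrite mulrC -ler_pdivlMr// ltW// Hc// zP.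
  have muCW : (mu0 (~` W) <= 0)%E.
    apply: le_trans (content_ext_open nu0 nu_ge0 (closed_openC cW)) _.
    rewrite /nu (_ : r @^-1` _ = set0); last first.
      by rewrite -subset0 => g /=; apply; exact: rW.
    by rewrite -(preimage_set0 r) -/(nu set0) nu0.
  have muW : (mu0 W <= 0)%E.
    have -> : W = \big[setU/set0]_(i <- index_enum I) (T (z i)^-1%g @^-1` A).
      rewrite -bigcup_seq /W eqEsubset; split=> x [i _ Hx]; exists i => //=.
      by rewrite mem_index_enum.
    elim/big_ind : _ => [|B C B0 C0|i _]; first by rewrite outer_measure0.
      by apply: le_trans (outer_measureU2 _ _ _) _; rewrite -[leRHS]adde0 leeD.
    by rewrite mu0_preimage -muE muA.
  have := outer_measureU2 mu0 W (~` W); rewrite setUv mu0T => /le_trans.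
  by move=> /(_ 0%E)/implyP; rewrite -[X in (_ <= X)%E](adde0 0%E) leeD// lee_fin ler10.
- move=> g; apply: contraPP => /= /negP; rewrite -leNgt => eg.
  suff -> : A `&` T g @` A = set0 by rewrite measure0 ltxx.
  rewrite -subset0 => x [Ax [y Ay Tyx]].
  have : `|r g - 1%:M| <= N%:R * del + del.
    have -> : r g - 1%:M = r g *m (1%:M - y) + (x - 1%:M).
      by rewrite mulmxBr mulmx1 -Tyx /T addrA subrK.
    apply: le_trans (ler_normD _ _) _; apply: lerD => //.
    apply: le_trans (mx_norm_mul _ _) _; rewrite -mulrA ler_wpM2l//.
    rewrite -[leRHS]mul1r ler_pM//; first exact: brep_le1.
    by rewrite distrC.
  rewrite -{2}[del]mul1r -mulrDl natr1 /del mulrC divfK// => /(le_trans eg).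
  by rewrite leNgt ltr_pdivrMr// ltr_pMr ?ltr1n.
Qed.

End RepReturnTimes.

(** * Bohr sets and the final construction *)

Section CompactExhaustion.
Variable G : topologicalGroupType.

(** The exhausting sets are finite unions of the compact closures of basic open sets; by local
    compactness the basic open sets with compact closure cover [G]. *)
Lemma compact_exhaustion : locally_compact [set: G] -> @second_countable G ->
  exists K : nat -> set G, (forall n, compact (K n)) /\
    forall C, compact C -> exists n, C `<=` K n.
Proof.
move=> lcG [B cB [Bo Bb]].
have [B0|[f]] := pfcard_geP cB.
  by have [V []] := Bb (1%g : G) setT filterT; rewrite B0.
pose L k := if pselect (compact (closure (f k))) then closure (f k) else set0.
have cL k : compact (L k) by rewrite /L; case: pselect => [h|h]; [exact: h|exact: compact0].
exists (fun n => \big[setU/set0]_(k < n) L k); split=> [n|C cC].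
  by apply: bigsetU_compact => i _; exact: cL.
apply: (compact_induction (P := fun A => exists n, A `<=` \big[setU/set0]_(k < n) L k)) cC _ _ _ _.
- by exists 0%N.
- by move=> A A' AA' [n A'n]; exists n; exact: subset_trans A'n.
- move=> A A' [n An] [p A'p]; exists (maxn n p) => x [/An|/A'p].
    by apply: subset_bigsetU; rewrite leq_maxl.
  by apply: subset_bigsetU; rewrite leq_maxr.
- move=> x _; have [U xU [cU clU]] := lcG x I.
  have {}xU : nbhs x U by move: xU; rewrite /within/=; apply: filterS => y; exact.
  have [V [BV Vx] VU] := Bb x _ xU.
  have [k _ fk] := @surj _ _ _ _ f V BV.
  exists V; first by apply: open_nbhs_nbhs; split=> //; exact: Bo.
  exists k.+1 => y [_ Vy]; rewrite big_ord_recr/=; right; rewrite /L fk.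
  case: pselect => [h|[]]; first exact: subset_closure.
  apply: (subclosed_compact _ cU); first exact: closed_closure.
  by apply: subset_trans (closureS VU) _; rewrite -(closure_id U).1.
Qed.

Lemma compact_mulg (A B : set G) : compact A -> compact B ->
  compact [set (p.1 * p.2)%g | p in A `*` B].
Proof.
move=> cA cB; apply: continuous_compact; last exact: compact_setX.
by apply: continuous_subspaceT; exact: mulg_continuous.
Qed.

Lemma compact_invg (A : set G) : compact A -> compact [set (x^-1)%g | x in A].
Proof.
by move=> cA; apply: continuous_compact => //; apply: continuous_subspaceT; exact: invg_continuous.
Qed.

End CompactExhaustion.

Section Assembly.
Variables (R : realType) (G : topologicalGroupType).
Variable m : {measure set (borel G) -> \bar R}.
Variable Phi : nat -> set G.
Hypotheses (hG : hausdorff_space G) (hm : left_Haar_measure m).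
Hypotheses (hPhi : left_Folner m Phi) (am : amenable m).
Hypothesis ncQ : ~ compact [set: von_neumann_quotient R G].

Local Notation rel A N := (relative_measure m A (Phi N)).

(** Disjointness with error 1 gives [k] times the relative measure at most 2, which explains the
    bound [2 / d]. *)
Lemma rel_eventually_le (A : set (borel G)) (d : R) (k : nat) (g : nat -> G) :
  0 < d -> 2 / d < k%:R -> measurable A ->
  (forall i j, (i < k)%N -> (j < k)%N -> i != j ->
    left_translate (g i) A `&` left_translate (g j) A = set0) ->
  \forall N \near \oo, rel A N <= d.
Proof.
move=> d0 kd mA gP.
have dg (i j : 'I_k) : i != j ->
    left_translate (g i) A `&` left_translate (g j) A = set0.
  by move=> ij; apply: gP.
apply: filterS (rel_disjoint_translates hG hm hPhi mA ltr01 dg) => N.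
have k0 : 0 < (k%:R : R) by apply: lt_trans kd; rewrite divr_gt0.
rewrite mulrC -ler_pdivlMr// => /le_trans; apply.
by rewrite ler_pdivrMr// mulrC -ler_pdivrMr// ltW.
Qed.

Lemma compact_density0 (C : set G) (d : R) : compact C -> 0 < d ->
  \forall N \near \oo, rel C N <= d.
Proof.
move=> cC d0; have kd := real_truncnS_gt (num_real (2 / d)).
have [g gP] := disjoint_translates ncQ (Num.truncn (2 / d)).+1 cC.
apply: (rel_eventually_le (g := g) d0 kd).
  by apply: closed_borel; exact: compact_closed.
move=> i j ik jk ij; rewrite -subset0 => x [[q Cq <-] [q' Cq' e]].
move/negP: (gP i j ik jk ij q q' Cq Cq'); apply.
by have -> : (g j * q')%g = (g i * q)%g := e; exact: coset_eq_refl.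
Qed.

(** At parameter 1 the Bohr set around [K^-1 K^-1] is still sparse, and at 1/2 it already contains
    [K^-1 U K^-1]. The interval in between is left for adjusting the radius. *)
Lemma bohr_filtration (K : set G) (d : R) : compact K -> 0 < d ->
  exists (D : R -> set G) (U : set G), [/\ ap_filtration D,
    forall s t, s <= t -> D s `<=` D t,
    \forall N \near \oo, rel (D 1) N <= d,
    return_time_set R U &
    forall k u l, K k -> U u -> K l -> D 2^-1 (k^-1 * u * l^-1)%g].
Proof.
move=> cK d0.
pose Q := [set (p.1 * p.2)%g | p in [set (x^-1)%g | x in K] `*` [set (x^-1)%g | x in K]].
have cQ : compact Q by apply: compact_mulg; exact: compact_invg.
pose k := (Num.truncn (2 / d)).+1.
have kd : 2 / d < k%:R by apply: real_truncnS_gt; exact: num_real.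
have [g gP] := disjoint_translates ncQ k cQ.
pose V i := [set (g i * x)%g | x in Q].
have cV i : compact (V i).
  by apply: continuous_compact => //; apply: continuous_subspaceT; exact: mulg_continuousl.
(* [W] collects the pairs of points from distinct translates of [Q]; being compact, it is separated
   by one representation at a uniform distance. *)
pose W := \big[setU/set0]_(ij : 'I_k * 'I_k | ij.1 != ij.2) (V ij.1 `*` V ij.2).
have cW : compact W by apply: bigsetU_compact => ij _; exact: compact_setX.
have WE x y : W (x, y) <-> exists i j : 'I_k, [/\ i != j, V i x & V j y].
  rewrite /W -bigcup_seq_cond; split=> [[[i j] /andP[_ ij] [Vx Vy]]|[i [j [ij Vx Vy]]]].
    by exists i, j.
  by exists (i, j) => //=; rewrite mem_index_enum.
have [|N [r [hr [e e0 He]]]] := @compact_rep_separated R G W cW.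
  move=> x y /WE[i [j [ij [q Qq <-] [q' Qq' <-]]]].
  by apply: coset_eq_rep; apply: gP.
have N0 : 0 < (N.+1%:R : R) by rewrite ltr0n.
(* After a left translation, a point within [t0] of [Q] is less than [e / 2] from the translate of
   [Q]. A common point of two translates of [D 1] would thus violate the separation [e]. *)
pose t0 : R := e / 2 / N.+1%:R; have t00 : 0 < t0 by rewrite !divr_gt0.
pose D s := [set h | exists2 q, Q q & `|r q - r h| < s * t0].
have hD : ap_filtration D by exact: (ap_filtration_scale t00 (brep_filtration hr Q)).
(* One factor for each of the translations by [k^-1] and [l^-1]: if [u] is this close to 1, then
   [k^-1 u l^-1] is within [t0 / 2] of [k^-1 l^-1]. *)
have d20 : 0 < 2^-1 * t0 / N.+1%:R / N.+1%:R by rewrite !divr_gt0// mulr_gt0.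
exists D, [set u | `|r u - 1%:M| < 2^-1 * t0 / N.+1%:R / N.+1%:R]; split=> //.
- move=> s t st x [q Qq qx]; exists q => //; apply: lt_le_trans qx _.
  by rewrite ler_wpM2r// ltW.
- apply: (rel_eventually_le (g := g) d0 kd); first by apply: open_borel; exact: (apf_open hD).
  move=> i j ik jk ij; rewrite -subset0 => x [[h [q Qq qh] hx] [h' [q' Qq' qh'] hx']].
  have : e <= `|r (g i * q)%g - r (g j * q')%g|.
    apply: He; apply/WE; exists (Ordinal ik), (Ordinal jk).
    by split=> //; [exists q|exists q'].
  have gh a b c : `|r a - r b| < 1 * t0 -> `|r (c * a)%g - r (c * b)%g| < e / 2.
    rewrite mul1r => ab; apply: le_lt_trans (brep_distl hr _ _ _) _.
    apply: (@le_lt_trans _ _ (N.+1%:R * `|r a - r b|)).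
      by rewrite ler_wpM2r// ler_nat.
    by rewrite mulrC -ltr_pdivlMr.
  have := gh _ _ (g i) qh; have := gh _ _ (g j) qh'.
  rewrite [(g i * h)%g]hx [(g j * h')%g]hx' distrC => h1 h2.
  rewrite leNgt => /negP; apply; rewrite -(subrKA (r x)).
  by apply: le_lt_trans (ler_normD _ _) _; rewrite [e]splitr ltrD.
- have [M [ML Mpos M1 Minv]] := am.
  exact: (rep_return_time_set ML Mpos M1 Minv hr d20).
- move=> a u b Ka Uu Kb; exists (a^-1 * b^-1)%g.
    by exists (a^-1, b^-1)%g => //; split; [exists a|exists b].
  rewrite -{1}[(a^-1)%g]mulg1; apply: le_lt_trans (brep_distr hr _ _ _) _.
  apply: (@le_lt_trans _ _ (N.+1%:R * (N.+1%:R * `|r 1%g - r u|))).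
    rewrite ler_pM ?ler_nat//; apply: le_trans (brep_distl hr _ _ _) _.
    by rewrite ler_wpM2r// ler_nat.
  by rewrite -ltr_pdivlMl// -ltr_pdivlMl// (brep1 hr) distrC [X in _ < X]mulrC [X in _ < X * _]mulrC.
Qed.

End Assembly.

Lemma cvg_approx (R : realType) (u : nat -> R) :
  (forall e, 0 < e -> exists2 w : nat -> R, cvgn w & \forall n \near \oo, `|u n - w n| <= e) ->
  cvgn u.
Proof.
move=> H; apply: cauchy_cvg; apply: cauchy_exP => e e0.
have e2 : 0 < e / 2 by rewrite divr_gt0.
have [w cw uw] := H _ e2; exists (limn w).
have ww := @cvgr_dist_lt _ _ _ _ _ w (limn w) cw _ e2.
change (\forall n \near \oo, ball (limn w) e (u n)).
have [p _ up] := uw; have [q _ wq] := ww.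
exists (maxn p q) => // n /=; rewrite geq_max => /andP[/up /= h1 /wq /= h2].
rewrite /ball /= -(subrKA (w n)); apply: le_lt_trans (ler_normD _ _) _.
by rewrite [e]splitr ltr_leD// distrC.
Qed.

Section ConvergenceOfUnions.
Variables (R : realType) (G : topologicalGroupType).
Variable m : {measure set (borel G) -> \bar R}.
Variable Phi : nat -> set G.
Hypotheses (hG : hausdorff_space G) (hm : left_Haar_measure m).
Hypothesis hPhi : left_Folner m Phi.

Local Notation rel A N := (relative_measure m A (Phi N)).

(** Countable subadditivity is applied at one fixed [N], so bounds that hold for every [N] pass to
    the union. *)
Lemma rel_bigcup_le (B : nat -> set (borel G)) (a : R) N : 0 <= a ->
  (forall k, measurable (B k)) -> (forall k, rel (B k) N <= a / (2 ^ k.+1)%:R) ->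
  rel (\bigcup_k B k) N <= a.
Proof.
move=> a0 mB Ba; have P0 := fine_folner_gt0 hm hPhi N.
have mP := measurable_folner hG hPhi N.
have mU : measurable (\bigcup_k B k) by exact: bigcup_measurable.
rewrite ler_pdivrMr// -lee_fin fineK; last exact: folner_fin_num.
have mBP k : measurable (B k `&` Phi N) by exact: measurableI.
have mUP : measurable (\bigcup_k (B k `&` Phi N)) by exact: bigcup_measurable.
rewrite setI_bigcupl; apply: le_trans (measure_sigma_subadditive m mBP mUP _) _ => //.
apply: le_trans (epsilon_trick0 xpredT (mulr_ge0 a0 (ltW P0))).
apply: lee_nneseries => // k _.
rewrite -(fineK (folner_fin_num hG hm hPhi N (mB k))) lee_fin mulrAC -ler_pdivrMr//.
exact: Ba.
Qed.

End ConvergenceOfUnions.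

(** * Construction of the dense set, its density, and the obstruction to recurrence *)

Theorem theorem1p11 (R : realType) (G : topologicalGroupType)
    (m : {measure set (borel G) -> \bar R}) :
  hausdorff_space G -> locally_compact [set: G] -> @second_countable G ->
  left_Haar_measure m -> amenable m ->
  ~ compact [set: von_neumann_quotient R G] ->
  forall Phi : nat -> set G, left_Folner m Phi ->
  forall eps : R, 0 < eps ->
  exists E : set (borel G),
    [/\ measurable E, has_density m Phi E, 1 - eps < density m Phi E &
        forall K : set G, compact K ->
          ~ exists2 S : set G, S `<=` two_sided_thickening K E &
                               measurable_recurrence R S].
Proof.
move=> hG lcG scG hm am ncQ Phi hPhi eps eps0.
pose rel (A : set (borel G)) N := relative_measure m A (Phi N).
have [K [cK KP]] := compact_exhaustion lcG scG.
(* Half of [eps], so that the final inequality stays strict in the limit. *)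
pose d0 := eps / 2; have d00 : 0 < d0 by rewrite divr_gt0.
pose d n : R := d0 / (2 ^ n.+1)%:R.
have dn0 n : 0 < d n by rewrite divr_gt0// ltr0n expn_gt0.
have H n := bohr_filtration hG hm hPhi am ncQ (cK n) (dn0 n).
have [D HD] := choice H; have [U {}HD] := choice HD.
have hD n : ap_filtration (D n) by case: (HD n).
have Dle n s t : s <= t -> D n s `<=` D n t by case: (HD n) => _ + _ _ _; apply.
have mD n s : measurable (D n s : set (borel G)).
  by apply: open_borel; exact: (apf_open (hD n)).
have Dd n : exists p, forall N, (p <= N)%N -> rel (D n 1) N <= d n.
  by case: (HD n) => _ _ [p _ Hp] _ _; exists p.
have [N0 N0P] := choice Dd.
(* Removing the Folner sets before [N0 n] makes the bound on [D n] hold at every index, with value 0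
   at the early ones. *)
pose C n : set G := \big[setU/set0]_(k < N0 n) Phi k.
have cC n : compact (C n) by apply: bigsetU_compact => k _; exact: (folner_compact hPhi).
have mC n : measurable (C n : set (borel G)) by apply: closed_borel; exact: compact_closed.
pose DU n s : set (borel G) := \big[setU/set0]_(k < n) D k s.
(* One parameter for which all finite unions [DU n s] have a density; each [n] excludes only
   countably many values. *)
have [s /andP[s1 s2] sP] : exists2 s : R, 2^-1 < s < 1 &
    ~ (\bigcup_n [set t | ~ has_density m Phi (DU n t)]) s.
  apply: countable_avoid; last by rewrite invf_lt1 ?ltr1n.
  apply: bigcup_countable => // n _.
  exact: (countable_nonconvergence hG hm hPhi am (ap_filtration_bigU n hD)).
have cDU n : has_density m Phi (DU n s).
  by apply: contrapT => nc; apply: sP; exists n.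
pose B n : set (borel G) := D n s `\` C n.
have mB n : measurable (B n) by exact: measurableD.
have Bd n N : rel (B n) N <= d n.
  have [nN|Nn] := leqP (N0 n) N.
    apply: le_trans (N0P n N nN); apply: (rel_le hG hm hPhi) => // x [Dx _].
    exact: Dle (ltW s2) _ Dx.
  rewrite /rel /relative_measure; have -> : B n `&` Phi N = set0.
    rewrite -subset0 => x [[_ nC] Px]; apply: nC; rewrite /C -bigcup_mkord.
    by exists N.
  by rewrite measure0 mul0r ltW.
pose F : set (borel G) := \bigcup_n B n.
have mF : measurable F by exact: bigcup_measurable.
pose BU n : set (borel G) := \big[setU/set0]_(k < n) B k.
pose CU n : set (borel G) := \big[setU/set0]_(k < n) C k.
have cCU n : compact (CU n : set G) by exact: bigsetU_compact.
have mBU n : measurable (BU n) by exact: bigsetU_measurable.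
have mCU n : measurable (CU n) by exact: bigsetU_measurable.
have mDU n : measurable (DU n s) by exact: bigsetU_measurable.
have tail n N : rel F N <= rel (BU n) N + d0 / (2 ^ n)%:R.
  have FE : F = BU n `|` \bigcup_k B (n + k)%N.
    rewrite eqEsubset; split=> [x [k _ Bx]|x].
      have [kn|nk] := ltnP k n; last by right; exists (k - n)%N => //; rewrite subnKC.
      by left; rewrite /BU -bigcup_mkord; exists k.
    case=> [|[k _ Bx]]; last by exists (n + k)%N.
    by rewrite /BU -bigcup_mkord => -[k _ Bx]; exists k.
  have mBn : measurable (\bigcup_k B (n + k)%N) by exact: bigcup_measurable.
  rewrite FE; apply: le_trans (relU_le hG hm hPhi N (mBU n) mBn) _.
  rewrite lerD2l; apply: (rel_bigcup_le hG hm hPhi) => // [|k]; first by rewrite divr_ge0// ltW.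
  apply: le_trans (Bd _ _) _; rewrite /d -mulrA -invfM -natrM -expnD addnS.
  exact: lexx.
(* Up to the tail, whose relative measure is small uniformly in [N], and the compact set [CU n] of
   density zero, [F] agrees with [DU n s], which has a density. *)
have cF : cvgn (rel F).
  apply: cvg_approx => e e0; have e2 : 0 < e / 2 by rewrite divr_gt0.
  have [n dn] : exists n, d0 / (2 ^ n)%:R <= e / 2.
    have k0 := real_truncnS_gt (num_real (d0 / (e / 2))).
    exists (Num.truncn (d0 / (e / 2))).+1.
    rewrite ler_pdivrMr ?ltr0n ?expn_gt0// mulrC -ler_pdivrMr//.
    by apply: le_trans (ltW k0) _; rewrite ler_nat ltnW// ltn_expl.
  exists (rel (DU n s)); first exact: cDU.
  have := compact_density0 hG hm hPhi ncQ (cCU n) e0.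
  apply: filterS => N CN; rewrite ler_distl; apply/andP; split.
    rewrite lerBlDr; apply: (@le_trans _ _ (rel (F `|` CU n) N)).
      apply: (rel_le hG hm hPhi) => //; first exact: measurableU.
      move=> x; rewrite /DU -(bigcup_mkord n (fun k => D k s)) => -[k /= kn Dx].
      have [Cx|nCx] := pselect (C k x); last by left; exists k.
      by right; rewrite /CU -bigcup_mkord; exists k.
    apply: le_trans (relU_le hG hm hPhi N mF (mCU n)) _.
    by rewrite lerD2l.
  apply: le_trans (tail n N) _; apply: lerD.
    apply: (rel_le hG hm hPhi) => //; rewrite /BU /DU.
    rewrite -bigcup_mkord -(bigcup_mkord n (fun k => D k s)).
    by move=> x [k kn [Dx _]]; exists k.
  by apply: le_trans dn _; rewrite ler_pdivrMr// ler_pMr ?ler1n.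
have relE N : rel (~` F) N = 1 - rel F N by exact: (relC hG hm hPhi).
have cE : cvgn (rel (~` F)).
  have -> : rel (~` F) = (fun N => 1 - rel F N) by apply/funext => N; exact: relE.
  by apply: is_cvgB => //; exact: is_cvg_cst.
exists (~` F); split=> //.
- exact: measurableC.
- apply: (@lt_le_trans _ _ (1 - d0)); first by rewrite ltrD2l ltrN2 /d0; lra.
  apply: limr_ge => //; apply: nearW => N; rewrite [leRHS]relE lerD2l lerN2.
  exact: (rel_bigcup_le hG hm hPhi (ltW d00) mB (fun k => Bd k N)).
move=> K1 cK1 [S SE Srec]; have [n K1n] := KP K1 cK1.
have [_ _ _ [dd [X [mu [T [A [sep act mA A0 ret]]]]]] UD] := HD n.
(* A return time [g = k x l] outside this compact set has [x] outside [C n], while [x = k^-1 g l^-1]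
   lies in [D n s]. So [x] belongs to [B n] and cannot be in [E]. *)
pose KCK := [set (p.1 * p.2)%g | p in [set (p.1 * p.2)%g | p in K n `*` C n] `*` K n].
have cKCK : compact KCK by apply: compact_mulg => //; exact: compact_mulg.
have [g [[Sg nKg] /ret Ug]] := Srec _ cKCK _ _ _ _ sep act A mA A0.
have [k [x [l [K1k Ex K1l gE]]]] := SE _ Sg.
apply: nKg; exists ((k * x)%g, l) => //=; split=> //=; last exact: K1n.
exists (k, x) => //=; split=> //=; first exact: K1n.
apply: contrapT => nCx; apply: Ex; exists n => //; split=> //.
apply: (Dle n _ _ (ltW s1)).
have := UD k g l (K1n _ K1k) Ug (K1n _ K1l).
by rewrite gE -!mulgA mulKg mulgV mulg1.
Qed.
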